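(* Let $(G,B)$ be a connected finite graph with boundary equipped with the unit weight. For $i=2,3,\dots,|\Omega|$, let $k=\left\lfloor\frac{|V|}{i}\right\rfloor$. Then: (1) when $i\nmid|V|$, $$\nu_i\ge2\left(1-\cos\frac{\pi}{2k+1}\right);$$ (2) when $i\mid|V|$, $$\nu_i\ge\lambda_1(P_{k+1},\{0\},m,w),$$ where $P_{k+1}$ is the path $0\sim1\sim2\sim\dots\sim k$ with boundary $\{0\}$, vertex-measure $m_j=1$ for $j=0,1,\dots,k$, and edge-weights $w_{12}=w_{23}=\dots=w_{k-1,k}=1$ and $w_{01}=\mu_i(P_i)$, the largest Laplacian eigenvalue of the path $P_i$ on $i$ vertices equipped with the unit weight.
   Context: A weighted finite graph $(G,m,w)$ is a finite simple graph $G$ with vertex set $V$ and edge set $E$, a vertex-measure $m:V\to(0,\infty)$ and an edge-weight $w:E\to(0,\infty)$; $w$ is extended to a symmetric function on $V\times V$ by $w_{xy}=0$ when $\{x,y\}\notin E$. The unit weight means $m\equiv1$ and $w\equiv1$ on $E$. A graph with boundary has in addition a nonempty subset $B\subset V$ (the boundary); $\Omega=V\setminus B$ is the interior. $\mathbb{R}^S$ is the space of real functions on $S$, with inner product $\langle u,v\rangle_S=\sum_{x\in S}u(x)v(x)m_x$. Laplacian: $\Delta u(x)=\frac1{m_x}\sum_{y\in V}(u(x)-u(y))w_{xy}$ for $u\in\mathbb{R}^V$; its eigenvalues, counted with multiplicity, are $0=\mu_1(G)\le\mu_2(G)\le\dots\le\mu_{|V|}(G)$. Dirichlet eigenvalues: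 for $u\in\mathbb{R}^\Omega$ let $E_0(u)\in\mathbb{R}^V$ be its extension by $0$ on $B$, and $\Delta^Du=(\Delta E_0(u))|_\Omega$, a nonnegative self-adjoint operator on $\mathbb{R}^\Omega$; its smallest eigenvalue is denoted $\lambda_1(G,B,m,w)$. Neumann Laplacian: for $u\in\mathbb{R}^\Omega$, let $N_0(u)\in\mathbb{R}^V$ be the function with $N_0(u)=u$ on $\Omega$ and $\Delta N_0(u)=0$ on $B$ (unique when $G$ is connected and $\Omega\neq\emptyset$). Set $\Delta^N u=(\Delta N_0(u))|_\Omega$, a nonnegative self-adjoint operator on $\mathbb{R}^\Omega$ with eigenvalues (Neumann eigenvalues), counted with multiplicity, $0\le\nu_1\le\dots\le\nu_{|\Omega|}$. *)

(* Defs.v *)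
From HB Require Import structures.
From mathcomp Require Import all_boot all_order all_algebra.
From mathcomp Require Import all_classical all_reals all_analysis.
Set Implicit Arguments. Unset Strict Implicit. Unset Printing Implicit Defensive.
Import Order.TTheory GRing.Theory Num.Theory.
Local Open Scope ring_scope.

Record sgraph (V : finType) := SGraph {
  adj : rel V;
  adj_sym : symmetric adj;
  adj_irr : irreflexive adj
}.

Definition graph_connected (V : finType) (G : sgraph V) : Prop :=
  forall x y : V, connect (adj G) x y.

Section Spectrum.
Context {R : realType} {U : vectType R}.

(* [s] lists, in nondecreasing order, the eigenvalues of [f], each repeated as
   many times as the dimension of its eigenspace.  Such an [s] always exists
   and is unique; the operators below are self-adjoint (when the weights are
   positive and symmetric) for the inner product weighted by the vertex-measure,
   so there [s] has [\dim {:U}] entries. *)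
Definition is_spectrum (f : 'End(U)) (s : seq R) : Prop :=
  sorted <=%R s /\ forall a : R, count_mem a s = \dim (passmx.leigenspace f a).

Definition spectrum (f : 'End(U)) : seq R := xget [::] (is_spectrum f).

(* The index [i] starts from 1. *)
Definition eigval (f : 'End(U)) (i : nat) : R := (spectrum f)`_(i.-1).

End Spectrum.

Section Operators.
Context {R : realType} {V : finType}.
Variables (G : sgraph V) (B : {set V}) (m : V -> R) (w : V -> V -> R).

(* Only the values of [w] on edges of [G] matter. *)
Definition ext_weight (x y : V) : R := if adj G x y then w x y else 0.

Definition laplacian (u : {ffun V -> R^o}) : {ffun V -> R^o} :=
  [ffun x => (m x)^-1 * \sum_(y : V) (u x - u y) * ext_weight x y].

Definition inner : finType := {x : V | x \notin B}.

Definition restrict (v : {ffun V -> R^o}) : {ffun inner -> R^o} :=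
  [ffun x => v (val x)].

Definition extend0 (u : {ffun inner -> R^o}) : {ffun V -> R^o} :=
  [ffun x => if insub x is Some z then u z else 0].

Definition dirichlet_laplacian (u : {ffun inner -> R^o}) :
    {ffun inner -> R^o} :=
  restrict (laplacian (extend0 u)).

Definition is_harmonic_ext (u : {ffun inner -> R^o}) (v : {ffun V -> R^o}) :
    Prop :=
  restrict v = u /\ forall x, x \in B -> laplacian v x = 0.

(* The default value [0] is not reached when [G] is connected, the weights are
   positive and symmetric, and [B] is not the whole of [V]: then the extension
   exists and is unique. *)
Definition neumann_ext (u : {ffun inner -> R^o}) : {ffun V -> R^o} :=
  xget 0 (is_harmonic_ext u).

Definition neumann_laplacian (u : {ffun inner -> R^o}) :
    {ffun inner -> R^o} :=
  restrict (laplacian (neumann_ext u)).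

(* [linfun f] coincides with [f] only when [f] is linear: the first two operators
   always are, and the Neumann one is under the conditions stated above. *)
Definition laplacian_eigval (i : nat) : R := eigval (linfun laplacian) i.

Definition dirichlet_eigval (i : nat) : R :=
  eigval (linfun dirichlet_laplacian) i.

Definition neumann_eigval (i : nat) : R := eigval (linfun neumann_laplacian) i.

End Operators.

Definition unit_measure {R : realType} {V : finType} : V -> R := fun=> 1.
Definition unit_weight {R : realType} {V : finType} : V -> V -> R :=
  fun _ _ => 1.

Section Path.
Variable n : nat.

Definition path_adj : rel 'I_n :=
  fun x y => (x.+1 == y :> nat) || (y.+1 == x :> nat).

Fact path_adj_sym : symmetric path_adj.
Proof. by move=> x y; rewrite /path_adj orbC. Qed.

Fact path_adj_irr : irreflexive path_adj.
Proof. by move=> x; rewrite /path_adj orbb; apply/negbTE; rewrite gtn_eqF. Qed.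

Definition path_graph : sgraph 'I_n := SGraph path_adj_sym path_adj_irr.

End Path.

(* On the path [0 ~ 1 ~ ... ~ k], the only edge at [0] is [{0, 1}]. *)
Definition path_weight {R : realType} (k : nat) (c : R) (x y : 'I_k.+1) : R :=
  if (x == ord0) || (y == ord0) then c else 1.

(* Main.v *)
(** The Neumann quadratic form at [u] is the energy of the harmonic extension of
    [u], whose norm is at least that of [u]; so by Courant-Fischer it suffices to
    find fewer than [i] linear conditions on functions [f] on [V] under which the
    energy of [f] is at least [a |f|^2], where [a] is the claimed bound; and [G]
    may be replaced by a rooted spanning tree.

    Rearrangement: on a subtree with at most [k] vertices, the energy plus
    [w min f^2] is at least [a |f|^2] if this holds for the path with [k] vertices
    and potential [w] at one end.

    If [i] does not divide [|V|], repeatedly impose [f v = 0] at a lowest vertex [v]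
    with more than [k] descendants: after at most [i - 1] steps every remaining
    piece has at most [k] vertices and touches a zero of [f].

    If [|V| = i k], take instead lowest vertices with at least [k] descendants.
    Either at some step there are more than [k] of them, and then [i - 1] vanishing
    conditions leave pieces with at most [k - 1] vertices; or the tree splits into
    [i] subtrees with [k] vertices.  In the latter case let [g > 0] satisfy
    [sum_(y ~ x) (g x + g y) >= mu_i(P_i) g x] on the quotient tree.  Requiring
    [f / g] to change sign, with equal absolute values, across each of the [i - 1]
    edges between subtrees turns the energy of these edges into a potential of total
    mass at least [mu_i(P_i)] on each subtree, and the rearrangement applies. *)
Require Import Defs.
From HB Require Import structures.
From mathcomp Require Import all_boot all_order all_algebra.
From mathcomp Require Import all_classical all_reals all_analysis.
From mathcomp Require Import finset spectral complex ring lra zify.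
Set Implicit Arguments. Unset Strict Implicit. Unset Printing Implicit Defensive.
Import Order.TTheory GRing.Theory Num.Theory.
Local Open Scope ring_scope.

(** * Spectra of self-adjoint operators *)

Section DotProduct.
Context {R : realType} {T : finType}.
Implicit Types (u v : {ffun T -> R^o}).

Definition dot u v : R := \sum_x u x * v x.

Lemma dotC u v : dot u v = dot v u.
Proof. by apply: eq_bigr => x _; rewrite mulrC. Qed.

Lemma dotDl u1 u2 v : dot (u1 + u2) v = dot u1 v + dot u2 v.
Proof. by rewrite -big_split; apply: eq_bigr => x _; rewrite ffunE mulrDl. Qed.

Lemma dotZl a u v : dot (a *: u) v = a * dot u v.
Proof. by rewrite mulr_sumr; apply: eq_bigr => x _; rewrite ffunE -mulrA. Qed.

Lemma dotZr a u v : dot u (a *: v) = a * dot u v.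
Proof. by rewrite dotC dotZl dotC. Qed.

Lemma dot0l v : dot 0 v = 0.
Proof. by rewrite /dot big1 // => x _; rewrite ffunE mul0r. Qed.

Lemma dotBl u1 u2 v : dot (u1 - u2) v = dot u1 v - dot u2 v.
Proof. by rewrite dotDl -scaleN1r dotZl mulN1r. Qed.

Lemma dot_suml I (r : seq I) (P : pred I) (F : I -> {ffun T -> R^o}) v :
  dot (\sum_(i <- r | P i) F i) v = \sum_(i <- r | P i) dot (F i) v.
Proof.
elim/big_rec2: _ => [|i y u _ <-]; first exact: dot0l.
by rewrite dotDl.
Qed.

Lemma dot_sumr I (r : seq I) (P : pred I) (F : I -> {ffun T -> R^o}) v :
  dot v (\sum_(i <- r | P i) F i) = \sum_(i <- r | P i) dot v (F i).
Proof. by rewrite dotC dot_suml; apply: eq_bigr => i _; rewrite dotC. Qed.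

Lemma dot_ge0 u : 0 <= dot u u.
Proof. by apply: sumr_ge0 => x _; rewrite -expr2 sqr_ge0. Qed.

Lemma dot_eq0 u : (dot u u == 0) = (u == 0).
Proof.
apply/eqP/eqP => [/eqP|->]; last exact: dot0l.
rewrite psumr_eq0 => [/allP u0|x _]; last by rewrite -expr2 sqr_ge0.
apply/ffunP => x; rewrite ffunE.
by have /eqP/eqP := u0 x (mem_index_enum x); rewrite -expr2 sqrf_eq0 => /eqP.
Qed.

Definition unit_fun (x : T) : {ffun T -> R^o} := [ffun y => (y == x)%:R].

Lemma dot_unit_fun x u : dot u (unit_fun x) = u x.
Proof.
rewrite /dot (bigD1 x) //= big1 ?addr0 ?ffunE ?eqxx ?mulr1 // => y yx.
by rewrite ffunE (negbTE yx) mulr0.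
Qed.

(** In such a basis coordinates are dot products, so a self-adjoint operator gets a symmetric
    matrix. *)
Lemma orthonormal_basis_exists :
  exists2 e : (\dim {: {ffun T -> R^o}}).-tuple {ffun T -> R^o},
    basis_of fullv e & forall i j : 'I_(\dim {: {ffun T -> R^o}}),
      dot e`_i e`_j = (i == j)%:R.
Proof.
pose s := [seq unit_fun x | x <- enum T].
have sz : size s = #|T| by rewrite size_map cardE.
have sE (i : 'I_(size s)) (x0 : T) : s`_i = unit_fun (nth x0 (enum T) i).
  by rewrite (nth_map x0) // -cardE -sz.
have on (i j : 'I_(size s)) : dot s`_i s`_j = (i == j)%:R.
  have /card_gt0P[x0 _] : (0 < #|T|)%N.
    by rewrite -sz (leq_ltn_trans (leq0n i)).
  by rewrite !(sE _ x0) dot_unit_fun ffunE nth_uniq ?enum_uniq -?cardE -?sz // eq_sym.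
have sb : basis_of fullv s.
  rewrite basisEfree subvf; apply/and3P; split=> //.
    rewrite -[s]/(tval (in_tuple s)); apply/freeP; move=> c c0 k.
    have := congr1 (fun u => dot u s`_k) c0; rewrite dot0l dot_suml.
    rewrite (bigD1 k) //= big1 ?addr0 => [|l lk].
      by rewrite dotZl on eqxx mulr1.
    by rewrite dotZl on (negbTE lk) mulr0.
  by rewrite dimvf sz /dim /= muln1.
have sz' : size s == \dim {: {ffun T -> R^o}} by rewrite (size_basis (X:=in_tuple s)).
exists (Tuple sz') => // i j.
have ei : (i < size s)%N by rewrite (eqP sz').
have ej : (j < size s)%N by rewrite (eqP sz').
exact: (on (Ordinal ei) (Ordinal ej)).
Qed.

End DotProduct.

Import passmx.

(** Over the complex numbers [M] is Hermitian, hence unitarily diagonalizable with real eigenvalues.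
    By [real_similar] the similarity may be taken with real entries, and real parts bring it back to
    [R]. *)
Lemma symmetric_diagonalizable (R : realType) n (M : 'M[R]_n) :
  M^T = M -> exists2 Q : 'M[R]_n, Q \in unitmx &
    exists D : 'rV[R]_n, Q *m M = diag_mx D *m Q.
Proof.
move=> Msym; pose A := map_mx (real_complex R) M.
have Areal : A \is a mxOver Num.real.
  by apply/mxOverP => i j; rewrite mxE complex_real.
have Aherm : A \is hermsymmx.
  apply: realsym_hermsym => //; apply/is_hermitianmxP.
  by rewrite expr0 scale1r map_mx_id // map_trmx Msym.
have /orthomx_spectralP AE := hermitian_normalmx Aherm.
have Dreal := hermitian_spectral_diag_real Aherm.
set P := spectralmx A in AE; set D := spectral_diag A in AE Dreal.
have Punit : P \in unitmx := spectral_unit A.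
have DDreal : diag_mx D \is a mxOver Num.real.
  apply/mxOverP => i j; rewrite !mxE; case: eqP => _; last exact: real0.
  exact: (mxOverP Dreal).
have [|Q] := real_similar _ Areal DDreal.
  by exists P => //; apply/similarP => //; rewrite {1}AE !mulmxA mulmxV ?mul1mx.
rewrite inE /= => /andP[Qreal Qunit] /(similarP Qunit) QA.
pose re m p (N : 'M[R[i]]_(m, p)) := map_mx (@complex.Re R) N.
have reK m p (N : 'M[R[i]]_(m, p)) :
    N \is a mxOver Num.real -> map_mx (real_complex R) (re _ _ N) = N.
  by move=> /mxOverP Nr; apply/matrixP => i j; rewrite !mxE RRe_real.
exists (re _ _ Q); first by rewrite -(map_unitmx (real_complex R)) reK.
exists (re _ _ D); apply: (map_mx_inj (f := real_complex R)).
by rewrite !map_mxM map_diag_mx !reK.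
Qed.

Lemma symmetric_mxof_eigenbasis (R : realType) (U : vectType R) (f : 'End(U))
    (e : (\dim {:U}).-tuple U) :
  basis_of fullv e -> (mxof e e f)^T = mxof e e f ->
  exists2 b : (\dim {:U}).-tuple U, basis_of fullv b &
    exists d : 'I_(\dim {:U}) -> R, forall j : 'I_(\dim {:U}),
      f b`_j = d j *: b`_j.
Proof.
(* The rows of [Q], read as coordinates in [e], are the eigenvectors. *)
move=> eb /symmetric_diagonalizable[Q Qunit [D QM]].
pose bf j : U := vecof e (row j Q).
pose b := [tuple bf j | j < \dim {:U}].
have bE (j : 'I_(\dim {:U})) : b`_j = bf j by rewrite -tnth_nth tnth_mktuple.
exists b; last first.
  exists (fun j => D 0 j) => j; rewrite bE /bf (hom_vecof _ eb).
  rewrite -row_mul QM row_mul.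
  have -> : row j (diag_mx D) = D 0 j *: delta_mx 0 j.
    apply/rowP => l; rewrite !mxE eqxx /=.
    by case: eqVneq => [->|]; rewrite ?mulr1 ?mulr0 ?mulr1n ?mulr0n.
  by rewrite -scalemxAl -rowE linearZ.
rewrite basisEdim size_tuple leqnn andbT.
apply/subvP => u _; rewrite (coord_basis eb (memvf u)).
apply: memv_suml => i _; apply: memvZ.
rewrite -vecof_delta -[delta_mx _ _]mulmx1 -(mulVmx Qunit) mulmxA -rowE.
rewrite mulmx_sum_row linear_sum; apply: memv_suml => j _; rewrite linearZ /=.
apply/memvZ/memv_span; rewrite -[vecof _ _]/(bf j) -bE.
by apply: mem_nth; rewrite size_tuple.
Qed.

Section SelfAdjoint.
Context {R : realType} {T : finType}.
Notation U := {ffun T -> R^o}.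
Variable f : 'End(U).
Hypothesis f_sym : forall u v, dot (f u) v = dot u (f v).

Lemma self_adjoint_eigenbasis :
  exists2 b : (\dim {:U}).-tuple U, basis_of fullv b &
    exists d : 'I_(\dim {:U}) -> R, forall j : 'I_(\dim {:U}),
      f b`_j = d j *: b`_j.
Proof.
have [e eb eon] := @orthonormal_basis_exists R T.
have coord_dot j u : coord e j u = dot u e`_j.
  rewrite [in RHS](coord_basis eb (memvf u)) dot_suml (bigD1 j) //=.
  rewrite big1 ?addr0 => [|l lj]; first by rewrite dotZl eon eqxx mulr1.
  by rewrite dotZl eon (negbTE lj) mulr0.
apply: (symmetric_mxof_eigenbasis eb); apply/matrixP => i j.
rewrite !mxE /= !vecof_delta.
rewrite !coord_dot. by rewrite f_sym dotC.
Qed.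

End SelfAdjoint.

Section Eigenbasis.
Context {R : realType} {U : vectType R}.
Variables (f : 'End(U)) (b : (\dim {:U}).-tuple U) (d : 'I_(\dim {:U}) -> R).
Hypothesis b_basis : basis_of fullv b.
Hypothesis fb : forall j : 'I_(\dim {:U}), f b`_j = d j *: b`_j.

Let n := \dim {:U}.

Definition eigen_family (P : pred R) : seq U :=
  [seq v <- b | [exists j : 'I_n, (b`_j == v) && P (d j)]].

Lemma eigen_family_free P : free (eigen_family P).
Proof. exact: filter_free (basis_free b_basis). Qed.

Lemma basis_nth_inj (j l : 'I_n) : b`_j = b`_l -> j = l.
Proof.
move=> /eqP; rewrite nth_uniq ?size_tuple //; last exact: free_uniq (basis_free b_basis).
by move=> /eqP/val_inj.
Qed.

Lemma in_eigen_family P (j : 'I_n) : (b`_j \in eigen_family P) = P (d j).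
Proof.
rewrite mem_filter mem_nth ?size_tuple // andbT.
apply/existsP/idP => [[l /andP[/eqP/basis_nth_inj ->]] //|Pj].
by exists j; rewrite eqxx.
Qed.

Lemma basis_codom : b = [seq b`_j | j : 'I_n <- enum 'I_n] :> seq U.
Proof.
rewrite -[LHS](@mkseq_nth _ 0) size_tuple /mkseq -val_enum_ord -map_comp.
exact: eq_map.
Qed.

Lemma size_eigen_family P :
  size (eigen_family P) = count P [seq d j | j <- enum 'I_n].
Proof.
rewrite /eigen_family size_filter count_map {2}basis_codom count_map.
apply: eq_count => j /=.
apply/existsP/idP => [[l /andP[/eqP/basis_nth_inj ->]] //|Pj].
by exists j; rewrite eqxx.
Qed.

Lemma coord_eigen_family P u : u \in <<eigen_family P>>%VS ->
  forall j, ~~ P (d j) -> coord b j u = 0.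
Proof.
move=> uX j nPj.
rewrite [u](@coord_span _ _ _ (in_tuple (eigen_family P))) //.
rewrite linear_sum big1 // => l _; rewrite linearZ /=.
have lX : (eigen_family P)`_l \in eigen_family P by rewrite mem_nth.
have /(nthP 0)[m mn bm] : (eigen_family P)`_l \in b.
  by move: lX; rewrite mem_filter => /andP[].
rewrite size_tuple in mn; move: lX; rewrite -bm.
rewrite (in_eigen_family P (Ordinal mn)) => Pm.
rewrite (coord_free (Ordinal mn) j (basis_free b_basis)).
by case: eqP => [ej|]; rewrite ?mulr0 ?scaler0 //; rewrite -ej Pm in nPj.
Qed.

Lemma eigen_family_span P u :
  (forall j, ~~ P (d j) -> coord b j u = 0) -> u \in <<eigen_family P>>%VS.
Proof.
move=> u0; rewrite (coord_basis b_basis (memvf u)); apply: memv_suml => j _.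
have [Pj|/u0 ->] := boolP (P (d j)); last by rewrite scale0r mem0v.
by apply/memvZ/memv_span; rewrite in_eigen_family.
Qed.

Lemma leigenspace_eigen_family a :
  leigenspace f a = <<eigen_family (pred1 a)>>%VS.
Proof.
apply/vspaceP => u; rewrite memv_ker !lfunE /= lfunE /= lfunE /= subr_eq0 id_lfunE.
have fuE : f u = \sum_j coord b j u *: (d j *: b`_j).
  rewrite {1}(coord_basis b_basis (memvf u)) linear_sum.
  by apply: eq_bigr => j _; rewrite linearZ /= fb.
apply/eqP/idP => [fu|/coord_eigen_family uX].
  apply: eigen_family_span => j /= dj; apply/eqP.
  have : coord b j (f u) = a * coord b j u by rewrite fu linearZ.
  rewrite fuE; under eq_bigr do rewrite scalerA.
  rewrite coord_sum_free ?(basis_free b_basis) // mulrC => /eqP.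
  by rewrite -subr_eq0 -mulrBl mulf_eq0 subr_eq0 (negbTE dj).
rewrite fuE [in RHS](coord_basis b_basis (memvf u)) scaler_sumr.
apply: eq_bigr => j _; rewrite !scalerA.
have [->|dj] := eqVneq (d j) a; first by rewrite mulrC.
by rewrite uX ?mul0r ?mulr0.
Qed.

(** A sorted sequence is determined by its multiplicities, so the choice made by [spectrum] can only
    be this one. *)
Lemma spectrum_eigenbasis : spectrum f = sort <=%R [seq d j | j <- enum 'I_n].
Proof.
have dimE a : count_mem a [seq d j | j <- enum 'I_n] = \dim (leigenspace f a).
  rewrite leigenspace_eigen_family -size_eigen_family.
  by rewrite (eqP (eigen_family_free _)).
have : is_spectrum f (spectrum f).
  apply: xgetPex; exists (sort <=%R [seq d j | j <- enum 'I_n]).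
  split=> [|a]; first exact: sort_sorted (@le_total _ _) _.
  by rewrite -dimE; apply/permP; rewrite perm_sort.
case=> s_sorted s_count; apply: (sorted_eq le_trans le_anti) => //.
  exact: sort_sorted (@le_total _ _) _.
apply/allP => a _ /=; rewrite s_count -dimE; apply/eqP/esym/permP.
by rewrite perm_sort.
Qed.

End Eigenbasis.

(** Each linear form lowers the dimension by at most one. *)
Lemma common_kernel_vector (K : fieldType) (U : vectType K) (W : {vspace U})
    (L : seq 'Hom(U, K^o)) :
  (size L < \dim W)%N ->
  exists2 u, u \in W & u != 0 /\ forall l, l \in L -> l u = 0.
Proof.
elim: L W => [|l L IH] W /= LW.
  exists (vpick W); rewrite ?memv_pick // vpick0 -dimv_eq0 -lt0n.
  by split.
have lW : (\dim (l @: W) <= 1)%N.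
  by rewrite (leq_trans (dimvS (subvf _))) // dimvf /dim.
have [|u] := IH (W :&: lker l)%VS.
  by have := limg_ker_dim l W; lia.
rewrite memv_cap memv_ker => /andP[uW /eqP lu] [u0 uL]; exists u => //.
by split=> // k; rewrite inE => /predU1P[->|/uL].
Qed.

(** * Courant-Fischer bounds *)

Section Rayleigh.
Context {R : realType} {T : finType}.
Notation U := {ffun T -> R^o}.
Variable f : 'End(U).
Hypothesis f_sym : forall u v, dot (f u) v = dot u (f v).

Section Eigenbasis.
Variables (b : (\dim {:U}).-tuple U) (d : 'I_(\dim {:U}) -> R).
Hypothesis b_basis : basis_of fullv b.
Hypothesis fb : forall j : 'I_(\dim {:U}), f b`_j = d j *: b`_j.

(* Eigenvectors with distinct eigenvalues are orthogonal, so [w (d j)] can be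
   split as a product of square roots without assuming [b] orthogonal. *)
Lemma dot_eigen_sum (w : R -> R) (c : 'I_(\dim {:U}) -> R) :
  (forall j, c j != 0 -> 0 <= w (d j)) ->
  let v := \sum_j (c j * Num.sqrt (w (d j))) *: b`_j in
  dot (\sum_j (c j * w (d j)) *: b`_j) (\sum_j c j *: b`_j) = dot v v.
Proof.
move=> w0; rewrite /= !dot_suml; apply: eq_bigr => j _.
rewrite !dot_sumr; apply: eq_bigr => l _; rewrite !(dotZl, dotZr).
have [dd|dd] := eqVneq (d j) (d l).
  have [->|cj] := eqVneq (c j) 0; first by rewrite !(mul0r, mulr0).
  by rewrite -dd -{1}(sqr_sqrtr (w0 _ cj)); ring.
suff -> : dot b`_j b`_l = 0 by rewrite !mulr0.
have := f_sym b`_j b`_l; rewrite !fb dotZl dotZr => /eqP.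
by rewrite -subr_eq0 -mulrBl mulf_eq0 subr_eq0 (negbTE dd) => /eqP.
Qed.

Lemma eigen_shift (a : R) u :
  f u - a *: u = \sum_j (coord b j u * (d j - a)) *: b`_j.
Proof.
rewrite {1 2}(coord_basis b_basis (memvf u)) linear_sum scaler_sumr -sumrB.
apply: eq_bigr => j _; rewrite linearZ /= fb !scalerA -scalerBl.
by congr (_ *: _); ring.
Qed.

End Eigenbasis.

Lemma eigval1_min u : eigval f 1 * dot u u <= dot (f u) u.
Proof.
have [b bb [d fb]] := self_adjoint_eigenbasis f_sym.
rewrite -subr_ge0 -dotZl -dotBl (eigen_shift bb fb).
rewrite {2}(coord_basis bb (memvf u)).
rewrite (dot_eigen_sum fb (w := fun x => x - eigval f 1)) ?dot_ge0 // => j _.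
rewrite subr_ge0 /eigval (spectrum_eigenbasis bb fb) /=.
set s := sort _ _.
have : d j \in s by rewrite mem_sort map_f ?mem_enum.
have : sorted <=%R s by exact: sort_sorted (@le_total _ _) _.
case: s => //= x s; rewrite le_path_sortedE => /andP[/allP xs _].
by rewrite inE => /predU1P[->|/xs].
Qed.

(** The first alternative accounts for an index out of range, where [nth] returns [0]. *)
Lemma eigval_eigenvector i :
  eigval f i = 0 \/ exists2 u, u != 0 & f u = eigval f i *: u.
Proof.
have [b bb [d fb]] := self_adjoint_eigenbasis f_sym.
rewrite /eigval (spectrum_eigenbasis bb fb); set s := sort _ _.
have [si|si] := leqP (size s) i.-1; first by left; rewrite nth_default.
right; have : s`_i.-1 \in s by rewrite mem_nth.
rewrite mem_sort => /mapP[j _ ->]; exists b`_j => //.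
by rewrite (basis_not0 bb) // mem_nth ?size_tuple.
Qed.

Lemma eigval_ge0 i : (forall u, 0 <= dot (f u) u) -> 0 <= eigval f i.
Proof.
move=> f0; have [->//|[u u0 fu]] := eigval_eigenvector i.
have u1 : 0 < dot u u by rewrite lt_def dot_eq0 u0 dot_ge0.
by rewrite -(pmulr_lge0 _ u1) -dotZl -fu.
Qed.

(** Courant-Fischer: if the [i]-th eigenvalue were below [a], the eigenvectors with eigenvalue below
    [a] would span at least [i] dimensions and so contain a nonzero common zero of [L], where the
    form is less than [a] times the squared norm. *)
Lemma eigval_ge (a : R) (L : seq 'Hom(U, R^o)) i :
  (size L < i <= #|T|)%N ->
  (forall u, (forall l, l \in L -> l u = 0) -> a * dot u u <= dot (f u) u) ->
  a <= eigval f i.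
Proof.
move=> /andP[Li iT] aL; rewrite leNgt; apply/negP => fi.
have [b bb [d fb]] := self_adjoint_eigenbasis f_sym.
move: fi; rewrite /eigval (spectrum_eigenbasis bb fb).
set s := sort _ _ => si.
have s_sorted : sorted <=%R s by exact: sort_sorted (@le_total _ _) _.
have sz : size s = #|T|.
  by rewrite size_sort size_map size_enum_ord dimvf /dim /= muln1.
pose P : pred R := fun x => x < a.
have iP : (i <= size (eigen_family b d P))%N.
  rewrite (size_eigen_family d bb).
  have /permP <- : perm_eq s [seq d j | j <- enum 'I_(\dim {:U})].
    by rewrite perm_sort.
  rewrite -{1}(size_takel (n0 := i) (s := s)) ?sz //.
  rewrite -[s in (_ <= count _ s)%N](cat_take_drop i) count_cat.
  suff : all P (take i s) by rewrite all_count => /eqP <-; exact: leq_addr.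
  apply/(all_nthP 0) => j; rewrite size_takel ?sz // => ji.
  rewrite nth_take // /P (le_lt_trans _ si) //.
  by apply: (sorted_leq_nth le_trans le_refl 0 s_sorted); rewrite ?inE ?sz; lia.
have [|u uW [u0 uL]] := @common_kernel_vector _ _ <<eigen_family b d P>>%VS L.
  by rewrite (eqP (eigen_family_free _ bb _)) (leq_trans Li).
have := aL u uL; apply/negP; rewrite -ltNge -subr_gt0 -dotZl -dotBl.
(* With the sign reversed, the weights [a - d j] are positive on every coordinate of [u] that
   occurs, and the form is a squared norm. *)
rewrite -opprB (eigen_shift bb fb) -sumrN.
under eq_bigr do rewrite -scaleNr -mulrN opprB.
rewrite {2}(coord_basis bb (memvf u)).
have Pc j : coord b j u != 0 -> d j < a.
  by apply: contraNT => /(coord_eigen_family bb uW) ->.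
rewrite (dot_eigen_sum fb (w := fun x => a - x)) => [|j /Pc /ltW]; last first.
  by rewrite subr_ge0.
rewrite lt_def dot_ge0 andbT dot_eq0; apply: contra u0 => /eqP v0.
rewrite (coord_basis bb (memvf u)) big1 // => j _.
have [->|cj] := eqVneq (coord b j u) 0; first by rewrite scale0r.
have := congr1 (coord b j) v0.
rewrite coord_sum_free ?(basis_free bb) // linear0 => /eqP.
by rewrite mulf_eq0 (negbTE cj) sqrtr_eq0 subr_le0 leNgt Pc.
Qed.

End Rayleigh.

(** * Rearrangement along a path *)

Section PathBound.
Context {R : realType}.

(* [a] is a lower bound of the quadratic form of the path with [k] interior
   vertices whose end [0] is joined to a Dirichlet vertex by an edge of weight
   [w]. *)
Definition path_bound (k : nat) (w a : R) : Prop := forall x : nat -> R,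
  a * \sum_(j < k) x j ^+ 2 <=
  w * x 0%N ^+ 2 + \sum_(j < k.-1) (x j.+1 - x j) ^+ 2.

Lemma path_bound_le k (w w' a : R) :
  w <= w' -> path_bound k w a -> path_bound k w' a.
Proof.
by move=> ww' kw x; rewrite (le_trans (kw x)) // lerD2r ler_wpM2r ?sqr_ge0.
Qed.

(** On functions vanishing at the first vertex, this vertex acts as a Dirichlet vertex joined to the
    other [k] by an edge of weight 1. *)
Lemma path_bound_pred k (w a : R) : path_bound k.+1 w a -> path_bound k 1 a.
Proof.
move=> kw x; have /= := kw (fun j => if j is j'.+1 then x j' else 0).
rewrite big_ord_recl expr0n /= add0r mulr0 add0r mul1r.
move=> /le_trans; apply; case: k {kw} => [|k].
  by rewrite !big_ord0 addr_ge0 ?sqr_ge0.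
rewrite big_ord_recl subr0 lerD2l.
by apply: ler_sum.
Qed.

(** The squares of nonnegative increments sum to at most the square of their sum. *)
Lemma sum_sqr_increments_le (h : nat -> R) a b : (a <= b)%N ->
  (forall j, (a <= j < b)%N -> h j <= h j.+1) ->
  h a <= h b /\ \sum_(a <= j < b) (h j.+1 - h j) ^+ 2 <= (h b - h a) ^+ 2.
Proof.
elim: b => [|b IH]; first by rewrite leqn0 => /eqP-> _; rewrite big_geq // sqr_ge0.
rewrite leq_eqVlt => /predU1P[-> _|ab hm].
  by rewrite big_geq // sqr_ge0.
have [|hab sab] := IH ab; first by move=> j jb; apply: hm; lia.
have hb : h b <= h b.+1 by apply: hm; lia.
rewrite big_nat_recr //=; split; first exact: le_trans hab hb.
by rewrite (le_trans (lerD sab (lexx _))) //; nra.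
Qed.

End PathBound.

Section Clusters.
Context {R : realType} {V : finType}.
Variables (p : V -> V) (d : V -> nat).

(** A subtree with top [t]. The decreasing depth [d] excludes cycles of [p] and makes [cluster_ind]
    well founded. *)
Definition cluster (C : {set V}) (t : V) : Prop :=
  t \in C /\ forall x, x \in C -> x != t -> p x \in C /\ (d (p x) < d x)%N.

Lemma cluster_ind (C : {set V}) t (P : V -> Prop) : cluster C t -> P t ->
  (forall x, x \in C -> x != t -> P (p x) -> P x) -> forall x, x \in C -> P x.
Proof.
move=> [_ Cp] Pt Ps x; have [m] := ubnP (d x).
elim: m x => // m IH x; rewrite ltnS => dx xC.
have [->//|xt] := eqVneq x t; have [pxC pd] := Cp x xC xt.
by apply: Ps => //; apply: IH => //; exact: leq_trans pd dx.
Qed.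

Definition energy_in (C : {set V}) (t : V) (f : V -> R) : R :=
  \sum_(x in C | x != t) (f x - f (p x)) ^+ 2.

(* Rearrange the values of [|f|] on [C] in increasing order along a path: every
   gap between two consecutive values is crossed by an edge of the cluster. *)
Lemma cluster_bound (C : {set V}) t k (w a : R) (f : V -> R) :
  cluster C t -> (#|C| <= k)%N -> 0 <= a -> path_bound k w a ->
  exists2 y, y \in C & (forall x, x \in C -> f y ^+ 2 <= f x ^+ 2) /\
    a * \sum_(x in C) f x ^+ 2 <= w * f y ^+ 2 + energy_in C t f.
Proof.
move=> Ct Ck a0 kw; have [tC Cp] := Ct.
pose le x y := `|f x| <= `|f y|.
pose s := sort le (enum C); set n := #|C| in Ck.
have sz : size s = n by rewrite size_sort -cardE.
have n0 : (0 < n)%N by apply/card_gt0P; exists t.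
have mem_s x : (x \in s) = (x \in C) by rewrite mem_sort mem_enum.
have s_sorted : sorted le s by apply: sort_sorted => x y; exact: le_total.
have le_tr : transitive le by move=> x y z; exact: le_trans.
have le_rf : reflexive le by move=> x; exact: lexx.
(* Capping the index continues the sorted values by a constant, which lengthens the path to [k]
   vertices without new increments. *)
pose h j := `|f (nth t s (minn j n.-1))|.
have hS j : h j <= h j.+1.
  by apply: (sorted_leq_nth le_tr le_rf t s_sorted); rewrite ?inE ?sz; lia.
have hidx x : x \in C -> h (index x s) = `|f x|.
  rewrite -mem_s /h => xs; have := xs; rewrite -index_mem sz => xn.
  by rewrite (_ : minn _ _ = index x s) ?nth_index //; lia.
have sC j : (j < n)%N -> nth t s j \in C by move=> jn; rewrite -mem_s mem_nth ?sz.
exists (nth t s 0); first exact: sC.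
have h0 : h 0%N = `|f (nth t s 0)| by rewrite /h min0n.
split=> [x xC|].
  rewrite -[leLHS]real_normK ?num_real // -[leRHS]real_normK ?num_real //.
  rewrite lerXn2r ?nnegrE // -h0 -hidx //.
  by have [] := @sum_sqr_increments_le _ h 0 (index x s).
have := kw h; rewrite h0 real_normK ?num_real // => kwh.
have sumC : \sum_(x in C) f x ^+ 2 = \sum_(j < n) h j ^+ 2.
  rewrite -big_enum /= -(perm_big _ (permEl (perm_sort le _))) -/s.
  rewrite (big_nth t) sz big_mkord; apply: eq_bigr => j _.
  by rewrite /h real_normK ?num_real // (minn_idPl _) // -ltnS prednK.
have sumle : \sum_(x in C) f x ^+ 2 <= \sum_(j < k) h j ^+ 2.
  rewrite sumC -!(big_mkord xpredT (fun j => h j ^+ 2)).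
  rewrite [leRHS](@big_cat_nat _ _ _ n) //= lerDl sumr_ge0 // => j _.
  exact: sqr_ge0.
apply: le_trans (ler_wpM2l a0 sumle) _; apply: le_trans kwh _; rewrite lerD2l.
pose delta j := (h j.+1 - h j) ^+ 2.
have -> : \sum_(j < k.-1) (h j.+1 - h j) ^+ 2 = \sum_(j < n.-1) delta j.
  rewrite -(big_mkord xpredT delta) -(big_mkord xpredT delta).
  rewrite (@big_cat_nat _ _ _ n.-1) //=; last by lia.
  rewrite [X in _ + X]big_nat [X in _ + X]big1 ?addr0 // => j /andP[nj _].
  by rewrite /delta /h (minn_idPr _) ?(minn_idPr _) ?subrr ?expr0n //; lia.
pose btw u v j := (index u s <= j < index v s)%N.
pose cross x j := btw x (p x) j || btw (p x) x j.
(* If no edge crossed gap [j], all of [C] would lie on the same side of it as [t]; but the first and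
   last vertices of [s] lie on opposite sides. *)
have crossP (j : 'I_n.-1) : exists2 x, (x \in C) && (x != t) & cross x j.
  have [x /andP[xC xj]|nc] :=
    pickP [pred x | ((x \in C) && (x != t)) && cross x j]; first by exists x.
  pose A x := (index x s <= j)%N.
  have At x : x \in C -> A x = A t.
    apply: (cluster_ind (P := fun x => A x = A t) Ct) => // z zC zt <-.
    have := nc z; rewrite /= zC zt /cross /btw /A.
    by case: (leqP (index z s)); case: (leqP (index (p z) s)) => //=; lia.
  have s_uniq : uniq s by rewrite sort_uniq enum_uniq.
  have := At _ (sC 0%N n0); rewrite -(At _ (sC n.-1 _)) ?prednK //.
  rewrite /A !index_uniq ?sz ?prednK //.
  by have := ltn_ord j; lia.
(* The gaps crossed by an edge fill the interval between the ranks of its ends, so their squares sum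
   to at most the square of the difference of the absolute values. *)
have E x : (x \in C) && (x != t) ->
    \sum_(j < n.-1 | cross x j) delta j <= (f x - f (p x)) ^+ 2.
  move=> /andP[xC xt]; have [pC _] := Cp x xC xt.
  have idx z : z \in C -> (index z s <= n.-1)%N.
    by rewrite -mem_s -index_mem sz; lia.
  have half u v : u \in C -> v \in C -> (index u s <= index v s)%N ->
      \sum_(j < n.-1 | btw u v j || btw v u j) delta j <= (f u - f v) ^+ 2.
    move=> uC vC uv.
    have [_ hs] := @sum_sqr_increments_le _ h _ _ uv (fun j _ => hS j).
    rewrite (eq_bigl (fun j : 'I_n.-1 => btw u v j)); last first.
      by move=> j; rewrite /btw; lia.
    rewrite -(big_mkord (btw u v) delta).
    apply: (@le_trans _ _ ((`|f v| - `|f u|) ^+ 2)).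
      rewrite -!hidx //; apply: le_trans hs.
      rewrite [leRHS](@big_nat_widen _ _ _ _ _ n.-1) ?idx //.
      rewrite [leRHS](@big_nat_widenl _ _ _ _ 0%N) //=.
      rewrite le_eqVlt; apply/orP; left; apply/eqP; apply: eq_bigl => j.
      by rewrite /btw andbC.
    rewrite -[leLHS]real_normK ?num_real // -[leRHS]real_normK ?num_real //.
    by rewrite lerXn2r ?nnegrE // [`|f u - f v|]distrC ler_dist_dist.
  have [uv|/ltnW vu] := leqP (index x s) (index (p x) s); first exact: half.
  rewrite -[leRHS]sqrrN opprB; apply: le_trans (half _ _ pC xC vu).
  rewrite (eq_bigl (fun j : 'I_n.-1 => btw (p x) x j || btw x (p x) j)) // => j.
  by rewrite orbC.
(* Count the pairs of a gap and an edge crossing it in both orders. *)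
apply: (@le_trans _ _ (\sum_(j < n.-1) \sum_(x in C | x != t)
  if cross x j then delta j else 0)).
  apply: ler_sum => j _; have [x xC xj] := crossP j.
  rewrite (bigD1 x) //= xj lerDl sumr_ge0 // => z _.
  by case: ifP => // _; exact: sqr_ge0.
rewrite exchange_big; apply: ler_sum => x xC.
by rewrite -big_mkcond; exact: E.
Qed.

End Clusters.

(** * Cutting rooted trees *)

Lemma linfun_linearE (K : fieldType) (aT rT : vectType K) (f : aT -> rT) :
  linear f -> linfun f =1 f.
Proof.
move=> fl; pose g : {linear aT -> rT} :=
  HB.pack f (GRing.isLinear.Build K aT rT *:%R f fl).
exact: (lfunE g).
Qed.

Section TwoPointForm.
Context {R : realType} {V : finType}.

(** Covers both kinds of linear condition: vanishing at a vertex, and gluing across an edge between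
    tiles. *)
Definition two_point_form (a : R) (x : V) (b : R) (y : V) :
    'Hom({ffun V -> R^o}, R^o) :=
  linfun (fun f : {ffun V -> R^o} => a * f x + b * f y : R^o).

Lemma two_point_formE a x b y f :
  two_point_form a x b y f = a * f x + b * f y.
Proof.
apply: linfun_linearE => c u v; rewrite !ffunE /GRing.scale /=.
ring.
Qed.

Definition point_eval (x : V) := two_point_form 1 x 0 x.

Lemma point_evalE x f : point_eval x f = f x.
Proof. by rewrite two_point_formE mul1r mul0r addr0. Qed.

End TwoPointForm.

Section RootedTree.
Context {R : realType} {V : finType}.
Variables (p : V -> V) (d : V -> nat) (r : V).
Hypothesis pr : p r = r.
Hypothesis dp : forall x, x != r -> (d (p x) < d x)%N.

Definition desc (v : V) : {set V} := [set x | fconnect p x v].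

(** This is the shape of what remains of the tree after branches are removed; unless empty, it
    contains the root. *)
Definition p_closed (U : {set V}) : Prop := forall x, x \in U -> p x \in U.

Lemma descP x v : reflect (exists n, iter n p x = v) (x \in desc v).
Proof.
rewrite inE; apply: (iffP idP) => [/iter_findex <-|[n <-]]; first by eexists.
exact: fconnect_iter.
Qed.

Lemma desc_refl v : v \in desc v.
Proof. by rewrite inE connect0. Qed.

Lemma desc_step x v : x \in desc v -> x != v -> p x \in desc v.
Proof.
move=> /descP[[|n]] /= xv; first by rewrite xv eqxx.
by move=> _; apply/descP; exists n; rewrite -iterSr.
Qed.

Lemma desc_parent x v : p x \in desc v -> x \in desc v.
Proof. by rewrite !inE; apply: connect_trans; exact: fconnect1. Qed.

Lemma iter_closed U n x : p_closed U -> x \in U -> iter n p x \in U.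
Proof. by move=> Up xU; elim: n => //= n; exact: Up. Qed.

Lemma desc_depth x v : x \in desc v -> (d v <= d x)%N.
Proof.
move=> /descP[n <-]; elim: n => //= n; apply: leq_trans.
by have [->|/dp/ltnW] := eqVneq (iter n p x) r; rewrite ?pr.
Qed.

Lemma root_desc v : r \in desc v -> v = r.
Proof. by move=> /descP[n <-]; elim: n => //= n ->. Qed.

Lemma closed_cluster U v : p_closed U -> v \in U -> cluster p d (U :&: desc v) v.
Proof.
move=> Up vU; split=> [|x]; first by rewrite inE vU desc_refl.
rewrite !in_setI => /andP[xU xv] xnv; rewrite Up // desc_step //; split=> //.
by apply: dp; apply: contraNneq xnv => xr; rewrite xr (root_desc (v := v)) // -xr.
Qed.

Lemma desc_root : desc r = [set: V].
Proof.
apply/setP => x; rewrite in_setT; have [m] := ubnP (d x).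
elim: m x => // m IH x; rewrite ltnS => dx.
have [->|xr] := eqVneq x r; first exact: desc_refl.
by apply/desc_parent/IH; rewrite (leq_trans (dp xr)).
Qed.

Lemma closed_root U x : p_closed U -> x \in U -> r \in U.
Proof.
move=> Up xU; have /descP[n <-] : x \in desc r by rewrite desc_root in_setT.
exact: iter_closed.
Qed.

Lemma closed_setD U v : p_closed U -> p_closed (U :\: desc v).
Proof.
move=> Up x; rewrite !in_setD => /andP[xv /Up ->]; rewrite andbT.
by apply: contra xv; exact: desc_parent.
Qed.

Definition child (v c : V) : bool := (p c == v) && (c != r).

Lemma desc_children U v x : p_closed U -> x \in U -> x \in desc v -> x != v ->
  exists2 c, c \in U & child v c && (x \in desc c).
Proof.
move=> Up xU xv xnv.
have [m] := ubnP (d x); elim: m x xU xv xnv => // m IH x xU xv xnv.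
rewrite ltnS => dx; have pxv := desc_step xv xnv.
have xr : x != r.
  by apply: contraNneq xnv => xr; rewrite xr (root_desc (v := v)) // -xr.
have [pv|pxnv] := eqVneq (p x) v.
  by exists x; rewrite // /child pv eqxx xr desc_refl.
have [|c cU /andP[cv /desc_parent pc]] := IH _ (Up _ xU) pxv pxnv.
  exact: leq_trans (dp xr) dx.
by exists c; rewrite ?cv.
Qed.

Lemma child_ndesc v c : child v c -> v \notin desc c.
Proof.
move=> /andP[/eqP <- cr]; apply/negP => /desc_depth.
by rewrite leqNgt dp.
Qed.

(** Both children lie on the way from [x] to the root. If they differed, the parent [v] of the lower
    one would descend from the upper one. *)
Lemma desc_child_uniq v c c' x : child v c -> child v c' ->
  x \in desc c -> x \in desc c' -> c = c'.
Proof.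
have W a b (n m : nat) : child v a -> child v b -> iter n p x = a ->
    iter m p x = b -> (n <= m)%N -> a = b.
  move=> va vb xa xb nm; apply/eqP; apply/negPn/negP => ab.
  have : a \in desc b.
    by apply/descP; exists (m - n)%N; rewrite -xa -iterD subnK.
  move=> /desc_step/(_ ab); have /andP[/eqP -> _] := va.
  by apply/negP; exact: child_ndesc.
move=> vc vc' /descP[n xc] /descP[m xc'].
by have [/W|/ltnW/W] := leqP n m; [apply|move=> H; apply/esym/H].
Qed.

Lemma sum_desc U v (F : V -> R) : p_closed U ->
  \sum_(x in U :&: desc v | x != v) F x =
  \sum_(c in U | child v c) \sum_(x in U :&: desc c) F x.
Proof.
move=> Up; pose ch x := odflt v [pick c | child v c && (x \in desc c)].
have chE x c : child v c -> x \in desc c -> ch x = c.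
  move=> vc xc; rewrite /ch; case: pickP => [c' /andP[vc' xc'] /=|/(_ c)].
    exact: desc_child_uniq vc' vc xc' xc.
  by rewrite vc xc.
rewrite (partition_big ch (fun c => (c \in U) && child v c)) /=.
  apply: eq_bigr => c /andP[cU vc]; apply: eq_bigl => x; rewrite !in_setI.
  apply/andP/andP => [[/andP[/andP[xU xv] xnv] /eqP xc]|[xU xc]].
    split=> //; have [c' _ /andP[vc' xc']] := desc_children Up xU xv xnv.
    by rewrite -xc (chE x c').
  rewrite (chE x c) // eqxx xU /=; split=> //; apply/andP; split.
    have /andP[/eqP <- _] := vc; have /descP[n <-] := xc.
    by apply/descP; exists n.+1.
  by apply: contraTneq xc => ->; exact: child_ndesc.
move=> x /andP[]; rewrite in_setI => /andP[xU xv] xnv.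
have [c cU /andP[vc xc]] := desc_children Up xU xv xnv.
by rewrite (chE x c) // cU.
Qed.

(** Among the vertices with more than [q] descendants in [U], take one with the fewest: the branch
    of a child is strictly smaller. *)
Lemma minimal_heavy_vertex U q : p_closed U -> (q < #|U|)%N ->
  exists2 v, v \in U & (q < #|U :&: desc v|)%N /\
    forall c, c \in U -> child v c -> (#|U :&: desc c| <= q)%N.
Proof.
move=> Up qU; have /card_gt0P[x0 x0U] : (0 < #|U|)%N by lia.
have rU := closed_root Up x0U.
have Pr : (r \in U) && (q < #|U :&: desc r|)%N by rewrite rU desc_root setIT.
case: (@arg_minnP V r [pred v | (v \in U) && (q < #|U :&: desc v|)%N]
  (fun v => #|U :&: desc v|) Pr) => v /andP[vU qv] vmin.
exists v => //; split=> // c cU vc; rewrite leqNgt; apply/negP => qc.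
have := vmin c; rewrite /= cU qc => /(_ isT); rewrite leqNgt => /negP; apply.
apply: proper_card; apply/properP; split.
  apply/fintype.subsetP => x; rewrite !in_setI => /andP[-> xc] /=.
  have /andP[/eqP <- _] := vc; have /descP[n <-] := xc.
  by apply/descP; exists n.+1.
by exists v; rewrite !in_setI vU ?desc_refl //= (child_ndesc vc).
Qed.

Lemma energy_in_cut (U : {set V}) v (f : V -> R) : v \in U -> v != r ->
  energy_in p U r f = energy_in p (U :&: desc v) v f +
    ((f v - f (p v)) ^+ 2 + energy_in p (U :\: desc v) r f).
Proof.
move=> vU vr; rewrite /energy_in (bigID (fun x => x \in desc v)) /=.
rewrite (bigD1 v) ?vU ?vr ?desc_refl //= [RHS]addrCA -[LHS]addrA; congr (_ + _).
have nr x : x \in desc v -> x != r.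
  by apply: contraTneq => ->; apply: contra vr => /root_desc ->.
congr (_ + _); apply: eq_bigl => x; rewrite !inE.
  have := nr x; rewrite inE.
  by case: (x \in U); case: (fconnect p x v) => //= H; rewrite ?andbF ?H.
by case: (x \in U); case: (fconnect p x v); case: (x != r).
Qed.

Section Cuts.
Variables (q : nat) (a : R).
Hypothesis a0 : 0 <= a.
Hypothesis qa : path_bound q 1 a.

(** As [f v = 0], the edge from a child [c] to [v] has energy [f c ^+ 2], at least the minimum of
    [f ^+ 2] on the branch of [c]. It serves as the unit potential in [cluster_bound]. *)
Lemma cut_bound U v (f : V -> R) : p_closed U -> v \in U -> f v = 0 ->
  (forall c, c \in U -> child v c -> (#|U :&: desc c| <= q)%N) ->
  a * \sum_(x in U :&: desc v) f x ^+ 2 <= energy_in p (U :&: desc v) v f.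
Proof.
move=> Up vU fv small; rewrite (bigD1 v) ?in_setI ?vU ?desc_refl //=.
rewrite fv expr0n add0r (sum_desc _ _ Up) mulr_sumr /energy_in (sum_desc _ _ Up).
apply: ler_sum => c /andP[cU vc].
have [y yC [ymin yb]] := cluster_bound f (closed_cluster Up cU) (small c cU vc) a0 qa.
have cC : c \in U :&: desc c by rewrite in_setI cU desc_refl.
apply: (le_trans yb); rewrite mul1r [leRHS](bigD1 c) //=.
have /andP[/eqP -> _] := vc; rewrite fv subr0 lerD2r.
exact: ymin.
Qed.

(** The edge from [v] to its parent leaves the contact term [f (p v) ^+ 2], with which the rest of
    the tree is treated in turn. *)
Lemma cut_step U v (L : seq 'Hom({ffun V -> R^o}, R^o)) :
  p_closed U -> v \in U ->
  (forall c, c \in U -> child v c -> (#|U :&: desc c| <= q)%N) ->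
  (v != r -> forall f : {ffun V -> R^o}, (forall l, l \in L -> l f = 0) ->
    a * \sum_(x in U :\: desc v) f x ^+ 2 <=
      f (p v) ^+ 2 + energy_in p (U :\: desc v) r f) ->
  forall f : {ffun V -> R^o}, (forall l, l \in point_eval v :: L -> l f = 0) ->
    a * \sum_(x in U) f x ^+ 2 <= energy_in p U r f.
Proof.
move=> Up vU small HL f fL.
have fv : f v = 0 by rewrite -point_evalE fL ?mem_head.
have [vr|vr] := eqVneq v r.
  by have := cut_bound Up vU fv small; rewrite vr desc_root setIT.
have fL' : forall l, l \in L -> l f = 0 by move=> l lL; rewrite fL // inE lL orbT.
have := lerD (cut_bound Up vU fv small) (HL vr f fL').
rewrite -mulrDr -big_setID /= => /le_trans; apply.
by rewrite (energy_in_cut f vU vr) fv sub0r sqrrN.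
Qed.

Lemma parent_setD U v : p_closed U -> v \in U -> v != r ->
  p v \in U :\: desc v.
Proof.
move=> Up vU vr; rewrite in_setD Up // andbT.
by apply: (child_ndesc (v := p v)); rewrite /child eqxx.
Qed.

Lemma light_contact_bound U x0 (f : V -> R) : p_closed U -> x0 \in U ->
  (#|U| <= q)%N ->
  a * \sum_(x in U) f x ^+ 2 <= f x0 ^+ 2 + energy_in p U r f.
Proof.
move=> Up x0U Uq.
have := closed_cluster Up (closed_root Up x0U).
rewrite desc_root setIT => Uc.
have [y yU [ymin]] := cluster_bound f Uc Uq a0 qa.
by rewrite mul1r => /le_trans; apply; rewrite lerD2r ymin.
Qed.

(** The size condition says [#|U| < (j + 1) (q + 1)]. Each cut removes at least [q + 1] vertices, so
    after [j] cuts at most [q] are left, still with a contact term. *)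
Lemma contact_bound j U x0 : p_closed U -> x0 \in U ->
  (#|U| <= j.+1 * q + j)%N ->
  exists2 L : seq 'Hom({ffun V -> R^o}, R^o), (size L <= j)%N &
    forall f : {ffun V -> R^o}, (forall l, l \in L -> l f = 0) ->
    a * \sum_(x in U) f x ^+ 2 <= f x0 ^+ 2 + energy_in p U r f.
Proof.
elim: j U x0 => [|j IH] U x0 Up x0U cU.
  by exists [::] => // f _; apply: light_contact_bound => //; lia.
have [Uq|qU] := leqP #|U| q.
  by exists [::] => // f _; apply: light_contact_bound.
have [v vU [qv small]] := minimal_heavy_vertex Up qU.
suff [L sL HL] : exists2 L : seq 'Hom({ffun V -> R^o}, R^o), (size L <= j)%N &
    v != r -> forall f : {ffun V -> R^o}, (forall l, l \in L -> l f = 0) ->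
    a * \sum_(x in U :\: desc v) f x ^+ 2 <=
      f (p v) ^+ 2 + energy_in p (U :\: desc v) r f.
  exists (point_eval v :: L) => // f fL.
  (* The contact at [p v] takes over from the one at [x0], whose term is dropped. *)
  by rewrite (le_trans (cut_step Up vU small HL fL)) // lerDr sqr_ge0.
have [vr|vr] := eqVneq v r; first by exists [::].
have [|L sL HL] := IH _ _ (closed_setD (v := v) Up) (parent_setD Up vU vr).
  by have := cardsID (desc v) U; nia.
by exists L.
Qed.

Lemma cut_contact_bound U v j : p_closed U -> v \in U ->
  (forall c, c \in U -> child v c -> (#|U :&: desc c| <= q)%N) ->
  (#|U :\: desc v| <= j.+1 * q + j)%N ->
  exists2 L : seq 'Hom({ffun V -> R^o}, R^o), (size L <= j.+1)%N &
    forall f : {ffun V -> R^o}, (forall l, l \in L -> l f = 0) ->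
    a * \sum_(x in U) f x ^+ 2 <= energy_in p U r f.
Proof.
move=> Up vU small cU.
have [vr|vr] := eqVneq v r.
  by exists [:: point_eval v] => // f; apply: cut_step => //; rewrite vr eqxx.
have [L sL HL] := contact_bound (closed_setD (v := v) Up) (parent_setD Up vU vr) cU.
by exists (point_eval v :: L) => // f; apply: cut_step.
Qed.

(** Here [#|V| < (j + 2) (q + 1)]; since [q < #|V|] there is a first cut, and it creates the first
    contact. *)
Lemma tree_bound j : (q < #|V| <= j.+2 * q + j.+1)%N ->
  exists2 L : seq 'Hom({ffun V -> R^o}, R^o), (size L <= j.+1)%N &
    forall f : {ffun V -> R^o}, (forall l, l \in L -> l f = 0) ->
    a * \sum_x f x ^+ 2 <= energy_in p [set: V] r f.
Proof.
move=> /andP[qV Vj].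
have Vp : p_closed [set: V] by move=> x _; rewrite in_setT.
rewrite -cardsT in qV Vj.
have [v vV [qv small]] := minimal_heavy_vertex Vp qV.
have [|L sL HL] := cut_contact_bound (j := j) Vp vV small.
  by have := cardsID (desc v) [set: V]; nia.
exists L => // f /HL; rewrite (eq_bigl predT) // => x; exact: in_setT.
Qed.

(* [tau] sends each vertex of [U] to the top of its tile; the tiles are
   subtrees of [k] vertices. *)
Definition tiling (U : {set V}) (k : nat) (tau : V -> V) : Prop :=
  (forall x, x \in U -> [/\ tau x \in U, tau (tau x) = tau x &
     tau x != x -> x != r /\ tau (p x) = tau x]) /\
  (forall t, t \in U -> tau t = t -> #|[set x in U | tau x == t]| = k).

(** A lowest branch with more than [q] vertices is split off as a tile if it has exactly [q + 1]. If
    it has more, cutting it leaves fewer than [(i - 1) (q + 1)] vertices, and [i - 1] cuts suffice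
    in all. *)
Lemma cut_or_tile i U : p_closed U -> #|U| = (i * q.+1)%N ->
  (exists2 L : seq 'Hom({ffun V -> R^o}, R^o), (size L < i)%N &
    forall f : {ffun V -> R^o}, (forall l, l \in L -> l f = 0) ->
    a * \sum_(x in U) f x ^+ 2 <= energy_in p U r f)
  \/ exists tau, tiling U q.+1 tau.
Proof.
elim: i U => [|i IH] U Up cU.
  have U0 : U = finset.set0 by apply/eqP; rewrite -cards_eq0 cU.
  by right; exists id; split=> x; rewrite U0 in_set0.
have qU : (q < #|U|)%N by rewrite cU; nia.
have [v vU [qv small]] := minimal_heavy_vertex Up qU.
have cD := cardsID (desc v) U.
have [cv|cv] := eqVneq #|U :&: desc v| q.+1; last first.
  left; have i0 : (0 < i)%N by case: i cU {IH} => // cU; move: qv cv; nia.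
  have [|L sL HL] := cut_contact_bound (j := i.-1) Up vU small.
    by rewrite prednK //; nia.
  by exists L => //; lia.
have [|[L sL HL]|[tau [tau1 tau2]]] := IH _ (closed_setD (v := v) Up).
- by rewrite mulSn in cU; lia.
(* If the rest has been settled by cuts, the branch of [v] is cut as well and its contact with the
   rest is dropped. *)
- left; exists (point_eval v :: L) => // f.
  apply: cut_step => // _ g /HL /le_trans; apply.
  by rewrite lerDr sqr_ge0.
right; exists (fun x => if x \in desc v then v else tau x); split=> [x xU|t tU].
  have [xv|xv] := boolP (x \in desc v).
    rewrite vU desc_refl; split=> // vx.
    rewrite desc_step //; last by rewrite eq_sym.
    split=> //; apply: contraNneq vx => xr.
    by rewrite (root_desc (v := v)) -?xr.
  have xUv : x \in U :\: desc v by rewrite in_setD xv.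
  have [] := tau1 x xUv; rewrite in_setD => /andP[/negbTE -> txU] tt tx.
  split=> // /tx [xr <-]; split=> //.
  by rewrite ifN //; apply: contra xv; exact: desc_parent.
have [tv|tv] := boolP (t \in desc v).
  move=> <-; rewrite -[RHS]cv; apply: eq_card => x; rewrite inE in_setI.
  have [xv|xv] := boolP (x \in desc v); first by rewrite eqxx.
  have [xU /=|//] := boolP (x \in U).
  have xUv : x \in U :\: desc v by rewrite in_setD xv.
  have [] := tau1 x xUv; rewrite in_setD => /andP[+ _] _ _.
  by apply: contraNF => /eqP ->; exact: desc_refl.
have tUv : t \in U :\: desc v by rewrite in_setD tv.
move=> /(tau2 t tUv) <-; apply: eq_card => x; rewrite in_set [RHS]in_set in_setD.
have [xv|//] := boolP (x \in desc v); rewrite andbC.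
by case: eqP => // vt; rewrite -vt desc_refl in tv.
Qed.

End Cuts.
End RootedTree.

(** * Gluing the tiles of a tree *)

Section Tilings.
Context {R : realType} {V : finType}.
Variables (p : V -> V) (d : V -> nat) (r : V).
Hypothesis dp : forall x, x != r -> (d (p x) < d x)%N.
Variables (k : nat) (tau : V -> V).
Hypothesis tauT : tiling p r [set: V] k tau.

Lemma tauK x : tau (tau x) = tau x.
Proof. by have [] := tauT.1 x (in_setT x). Qed.

Lemma tau_parent x : tau x != x -> x != r /\ tau (p x) = tau x.
Proof. by have [] := tauT.1 x (in_setT x). Qed.

Lemma tau_cluster t : tau t = t -> cluster p d [set x | tau x == t] t.
Proof.
move=> tt; split=> [|x]; rewrite !inE ?tt //.
move=> /eqP xt; rewrite -xt eq_sym => /tau_parent[/dp xr ->].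
by rewrite eqxx.
Qed.

Lemma tau_card t : tau t = t -> #|[set x | tau x == t]| = k.
Proof.
move=> /(tauT.2 t (in_setT t)) <-.
by apply: eq_card => x; rewrite !inE.
Qed.

Lemma sum_tau (F : V -> R) :
  \sum_x F x = \sum_(t | tau t == t) \sum_(x in [set x | tau x == t]) F x.
Proof.
rewrite (partition_big tau (fun t => tau t == t)) => [|x _] /=; last first.
  by rewrite tauK.
by apply: eq_bigr => t _; apply: eq_bigl => x; rewrite inE.
Qed.

Lemma card_tops : (#|[pred t | tau t == t]| * k)%N = #|V|.
Proof.
rewrite -sum_nat_const -[RHS]sum1_card.
rewrite [RHS](partition_big tau (fun t => tau t == t)) => [|x _] /=; last first.
  by rewrite tauK.
apply: eq_bigr => t /eqP/tau_card <-.
by rewrite -sum1_card; apply: eq_bigl => x; rewrite inE.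
Qed.

(** An upward edge leaves a tile only from its top. *)
Lemma energy_in_tau (f : V -> R) :
  energy_in p [set: V] r f =
  \sum_(t | tau t == t) energy_in p [set x | tau x == t] t f +
  \sum_(t | (tau t == t) && (t != r)) (f t - f (p t)) ^+ 2.
Proof.
rewrite /energy_in (eq_bigl (fun x => x != r)); last by move=> x; rewrite in_setT.
rewrite (bigID (fun x => tau x == x)) /= addrC; congr (_ + _); last first.
  by apply: eq_bigl => x; rewrite andbC.
rewrite (partition_big tau (fun t => tau t == t)) => [|x _] /=; last first.
  by rewrite tauK.
apply: eq_bigr => t _; apply: eq_bigl => x; rewrite inE.
have [<-|] := eqVneq (tau x) t; last by rewrite andbF.
rewrite andbT [x == tau x]eq_sym; have [|/tau_parent[-> _]] := eqVneq (tau x) x.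
  by rewrite andbF.
by [].
Qed.

Variables (w a : R) (g : V -> R).
Hypothesis g0 : forall x, 0 < g x.
Hypothesis wg : forall t, tau t = t -> w * g t <=
  (if t != r then g t + g (tau (p t)) else 0) +
  \sum_(c | [&& tau c == c, c != r & tau (p c) == t]) (g t + g c).

(** With [x = b s] and [y = - c s], the square [(x - y) ^+ 2 = (b + c) ^+ 2 * s ^+ 2] splits as
    [b (b + c) s ^+ 2 + c (b + c) s ^+ 2]. *)
Lemma glued_edge (x y b c m n : R) : 0 < b -> 0 < c -> c * x + b * y = 0 ->
  m ^+ 2 <= x ^+ 2 -> n ^+ 2 <= y ^+ 2 ->
  m ^+ 2 * ((b + c) / b) + n ^+ 2 * ((c + b) / c) <= (x - y) ^+ 2.
Proof.
move=> b0 c0 cxby mx ny.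
have -> : (x - y) ^+ 2 = x ^+ 2 * ((b + c) / b) + y ^+ 2 * ((c + b) / c).
  have -> : x = - (b / c) * y.
    have cx : c * x = - (b * y) by apply/eqP; rewrite -addr_eq0 cxby.
    by rewrite -[LHS](mulKf (lt0r_neq0 c0)) cx; ring.
  by field; rewrite !lt0r_neq0.
by apply: lerD; rewrite ler_wpM2r // ltW // divr_gt0 // addr_gt0.
Qed.

(* With [g] a positive supersolution of the signless Laplacian of the quotient
   tree, the conditions [f t / g t = - f (p t) / g (tau (p t))] on the edges
   between tiles split the energy of these edges into potentials of total mass
   at least [w] on each tile. *)
Lemma tiled_bound : 0 <= a -> path_bound k w a ->
  exists2 L : seq 'Hom({ffun V -> R^o}, R^o),
    (size L < #|[pred t | tau t == t]|)%N &
    forall f : {ffun V -> R^o}, (forall l, l \in L -> l f = 0) ->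
    a * \sum_x f x ^+ 2 <= energy_in p [set: V] r f.
Proof.
move=> a0 ka; pose edges := [pred t | (tau t == t) && (t != r)].
(* One condition per edge between tiles. The root is a top with no such edge above it, so there are
   fewer conditions than tiles. *)
exists [seq two_point_form (g (tau (p t))) t (g t) (p t) | t <- enum edges].
  rewrite size_map -cardE; apply: proper_card; apply/properP; split.
    by apply/fintype.subsetP => t /andP[].
  exists r; rewrite !inE ?eqxx ?andbF //; apply/negPn/negP => /tau_parent[].
  by rewrite eqxx.
move=> f fL.
have glue t : tau t = t -> t != r ->
    g (tau (p t)) * f t + g t * f (p t) = 0.
  move=> tt tr; rewrite -two_point_formE; apply: fL.
  by apply/mapP; exists t; rewrite // mem_enum inE tt eqxx.
(* For a top [t], [y t] is a vertex of its tile where [f ^+ 2] is least. *)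
have /choice[y yP] : forall t, exists y, tau t = t ->
    [/\ tau y = t, forall x, tau x = t -> f y ^+ 2 <= f x ^+ 2 &
    a * \sum_(x in [set x | tau x == t]) f x ^+ 2 <=
      w * f y ^+ 2 + energy_in p [set x | tau x == t] t f].
  move=> t; have [tt|tt] := eqVneq (tau t) t; last first.
    by exists t => /eqP; rewrite (negbTE tt).
  have [|y] := cluster_bound f (tau_cluster tt) _ a0 ka; first by rewrite tau_card.
  rewrite inE => /eqP yt [ymin yb]; exists y => _; split=> // x xt.
  by apply: ymin; rewrite inE xt.
rewrite sum_tau mulr_sumr energy_in_tau.
apply: (@le_trans _ _ (\sum_(t | tau t == t)
   (w * f (y t) ^+ 2 + energy_in p [set x | tau x == t] t f))).
  by apply: ler_sum => t /eqP /yP[].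
rewrite big_split /= addrC lerD2l.
(* The potential which an edge between the tiles of [b] and [c] gives to the tile of [b]. *)
pose W b c := (g b + g c) / g b.
apply: (@le_trans _ _ (\sum_(t | (tau t == t) && (t != r))
  (f (y t) ^+ 2 * W t (tau (p t)) + f (y (tau (p t))) ^+ 2 * W (tau (p t)) t))); last first.
  apply: ler_sum => t /andP[/eqP tt tr].
  have [_ ymin _] := yP t tt; have [_ ymin' _] := yP _ (tauK (p t)).
  by apply: glued_edge; rewrite ?g0 ?glue ?ymin ?ymin'.
(* Collect the upper ends of the edges by tile. The potentials on the tile of [t] then total at
   least [w], by [wg] divided by [g t]. *)
rewrite big_split /= [X in _ <= _ + X](partition_big (fun t => tau (p t))
  (fun t => tau t == t)) => [|t _] /=; last by rewrite tauK.
rewrite [X in _ <= X + _]big_mkcondr -big_split /=.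
apply: ler_sum => t /eqP tt.
rewrite (eq_bigr (fun c => f (y t) ^+ 2 * W t c)); last first.
  by move=> c /andP[_ /eqP ->].
rewrite -mulr_sumr.
have -> : (if t != r then f (y t) ^+ 2 * W t (tau (p t)) else 0) =
  f (y t) ^+ 2 * (if t != r then W t (tau (p t)) else 0).
  by case: ifP; rewrite ?mulr0.
rewrite -mulrDr mulrC ler_wpM2l ?sqr_ge0 //.
rewrite -(ler_pM2r (g0 t)) (le_trans (wg tt)) // mulrDl mulr_suml.
apply: lerD.
  by case: ifP => _; rewrite ?mul0r // /W divfK // gt_eqF.
rewrite le_eqVlt; apply/orP; left; apply/eqP.
apply: eq_big => [c|c _]; first by rewrite andbA.
by rewrite /W divfK // gt_eqF.
Qed.

End Tilings.

(** * Paths *)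

Section PathTrigonometry.
Context {R : realType}.

Lemma sin_add_sub (x y : R) : sin (x + y) + sin (x - y) = 2 * cos y * sin x.
Proof. by rewrite sinD sinB; ring. Qed.

Lemma sin_pi_sub (x : R) : sin (pi - x) = sin x.
Proof. by rewrite sinB sinpi cospi; ring. Qed.

(* Picone's identity with the first Dirichlet eigenfunction
   [j |-> sin (j pi / (2 k + 1))] of the path. *)
Lemma path_bound_cos k :
  path_bound k 1 (2 * (1 - cos (pi / (2 * k + 1)%:R)) : R).
Proof.
case: k => [|k] x; first by rewrite !big_ord0 mulr0 mul1r addr0 sqr_ge0.
set phi := pi / _; set a := 2 * _; rewrite mul1r [k.+1.-1]/=.
pose h m : R := sin (m%:R * phi).
have N0 : 0 < (2 * k.+1 + 1)%:R :> R by rewrite ltr0n addn1.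
have phi0 : 0 < phi by rewrite divr_gt0 ?pi_gt0.
have h0 m : (m <= k.+1)%N -> 0 < h m.+1.
  move=> mk; apply: sin_gt0_pi; rewrite mulr_gt0 //=.
  by rewrite /phi mulrA ltr_pdivrMr // mulrC ltr_pM2l ?pi_gt0 // ltr_nat; lia.
have hrec m : h m.+2 = (2 - a) * h m.+1 - h m.
  have := sin_add_sub (m.+1%:R * phi) phi.
  have -> : m.+1%:R * phi + phi = m.+2%:R * phi by rewrite -[m.+2]addn1 natrD; ring.
  have -> : m.+1%:R * phi - phi = m%:R * phi by rewrite -[m.+1]addn1 natrD; ring.
  rewrite -/(h _) -/(h _) -/(h _) /a => hh; apply/eqP.
  by rewrite eq_sym subr_eq hh; apply/eqP; ring.
(* The two angles add up to [pi]: this is the Neumann condition at the far end. *)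
have hend : h k.+2 = h k.+1.
  rewrite /h -sin_pi_sub; congr sin; rewrite /phi.
  have -> : k.+2%:R = (2 * k.+1 + 1)%:R - k.+1%:R :> R.
    by rewrite -natrB; [congr _%:R; lia|lia].
  by field; rewrite gt_eqF.
(* The coefficient left at vertex [m] once the squares on the earlier edges are completed. *)
pose c m := 1 - h m / h m.+1.
have step m : (m <= k)%N -> a * \sum_(j < m) x j ^+ 2 + c m * x m ^+ 2 <=
    x 0%N ^+ 2 + \sum_(j < m) (x j.+1 - x j) ^+ 2.
  elim: m => [|m IH] mk.
    by rewrite !big_ord0 mulr0 add0r addr0 /c /h mul0r sin0 mul0r subr0 mul1r.
  rewrite !big_ord_recr /= mulrDr addrA.
  apply: le_trans (lerD (IH (ltnW mk)) (lexx _)).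
  rewrite -addrA -[leRHS]addrA lerD2l.
  have h1 : 0 < h m.+1 by apply: h0; lia.
  have h2 : 0 < h m.+2 by apply: h0; lia.
  rewrite -subr_ge0 /c.
  have hm : h m = (2 - a) * h m.+1 - h m.+2 by rewrite hrec; ring.
  rewrite hm.
  have -> : (1 - ((2 - a) * h m.+1 - h m.+2) / h m.+1) * x m ^+ 2 +
    (x m.+1 - x m) ^+ 2 - (a * x m ^+ 2 + (1 - h m.+1 / h m.+2) * x m.+1 ^+ 2)
    = (h m.+2 * x m - h m.+1 * x m.+1) ^+ 2 / (h m.+1 * h m.+2).
    by field; rewrite !gt_eqF.
  by rewrite divr_ge0 ?sqr_ge0 // mulr_ge0 // ltW.
rewrite big_ord_recr /= mulrDr; apply: le_trans (step k (leqnn k)).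
(* By the recurrence and [hend], the last coefficient [c k] equals [a]. *)
rewrite lerD2l ler_wpM2r ?sqr_ge0 // /c.
have h1 := h0 k (leqnSn k).
have -> : h k = (2 - a) * h k.+1 - h k.+1 by rewrite -{2}hend hrec; ring.
by rewrite le_eqVlt; apply/orP; left; apply/eqP; field; rewrite gt_eqF.
Qed.

(* Largest Laplacian eigenvalue of the path on [n] vertices, and the absolute
   values of its eigenvector. *)
Definition path_top_value (n : nat) : R := 2 + 2 * cos (pi / n%:R).

Definition path_top_vector (n m : nat) : R :=
  sin ((2 * m + 1)%:R * (pi / (2 * n)%:R)).

Lemma path_top_value_le4 n : path_top_value n <= 4.
Proof. by rewrite /path_top_value; have := cos_le1 (pi / n%:R : R); lra. Qed.

Lemma path_top_vector_gt0 n m : (m < n)%N -> 0 < path_top_vector n m.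
Proof.
move=> mn; have n0 : 0 < (2 * n)%:R :> R by rewrite ltr0n; lia.
apply: sin_gt0_pi; rewrite mulr_gt0 ?ltr0n ?addn1 ?divr_gt0 ?pi_gt0 //=.
by rewrite mulrA ltr_pdivrMr // mulrC ltr_pM2l ?pi_gt0 // ltr_nat; lia.
Qed.

(** The sine is odd about [0] and [pi], so a missing neighbour at either end would carry the
    opposite value and contribute zero; the interior recurrence thus holds at the ends too. *)
Lemma path_top_vectorE n m : (m < n)%N ->
  path_top_value n * path_top_vector n m =
  (if m is m'.+1 then path_top_vector n m + path_top_vector n m' else 0) +
  (if (m.+1 < n)%N then path_top_vector n m + path_top_vector n m.+1 else 0).
Proof.
move=> mn; have n0 : 0 < n%:R :> R by rewrite ltr0n (leq_trans _ mn).
rewrite /path_top_vector /path_top_value; set psi := pi / (2 * n)%:R.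
have npsi : n%:R * (psi + psi) = pi.
  by rewrite /psi natrM; field; rewrite gt_eqF.
have -> : pi / n%:R = psi + psi by rewrite -npsi; field; rewrite gt_eqF.
have := sin_add_sub ((2 * m + 1)%:R * psi) (psi + psi).
have -> : (2 * m + 1)%:R * psi + (psi + psi) = (2 * m.+1 + 1)%:R * psi.
  by rewrite !natrD !natrM -[m.+1]addn1 natrD; ring.
set s := sin (_ * psi + - _); set s0 := sin ((2 * m + 1)%:R * psi) => hs.
have low : (if m is m'.+1 then s0 + sin ((2 * m' + 1)%:R * psi) else 0) = s0 + s.
  rewrite /s /s0; case: m {hs s s0 mn} => [|m].
    rewrite [_ - _](_ : _ = - ((2 * 0 + 1)%:R * psi)); last by rewrite mul1r; ring.
    by rewrite sinN subrr.
  congr (_ + sin _); rewrite !natrD !natrM -[m.+1]addn1 natrD; ring.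
have high : (if (m.+1 < n)%N then s0 + sin ((2 * m.+1 + 1)%:R * psi) else 0) =
    s0 + sin ((2 * m.+1 + 1)%:R * psi).
  case: ifPn => // nm; have {}mn : n = m.+1 by lia.
  rewrite /s0 -[in sin ((2 * m + 1)%:R * psi)]sin_pi_sub -npsi mn.
  have -> : m.+1%:R * (psi + psi) - (2 * m + 1)%:R * psi = psi.
    by rewrite -natr1 natrD natrM; ring.
  have -> : (2 * m.+1 + 1)%:R * psi = psi + pi.
    by rewrite -npsi mn natrD natrM; ring.
  by rewrite sinDpi subrr.
rewrite low high; transitivity (2 * s0 + 2 * cos (psi + psi) * s0); first by ring.
by rewrite -hs; ring.
Qed.

End PathTrigonometry.

(** * Supersolutions of the signless Laplacian *)

Lemma distance_exists (T : finType) (e : rel T) (c : T) :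
  (forall x, connect e c x) ->
  exists d : T -> nat, [/\ d c = 0%N,
    forall x, x != c -> exists2 y, e y x & d x = (d y).+1 &
    forall x y, e x y -> (d y <= (d x).+1)%N].
Proof.
move=> conn.
have /choice[d dP] : forall x, exists n,
    (exists2 s, path e c s & x = last c s /\ size s = n) /\
    (forall s, path e c s -> x = last c s -> (n <= size s)%N).
  move=> x.
  have ex : exists n, [exists s : n.-tuple T, path e c s && (x == last c s)].
    have /connectP[s es xs] := conn x.
    by exists (size s); apply/existsP; exists (in_tuple s); rewrite es xs /=.
  case: (ex_minnP ex) => n /existsP[s /andP[es /eqP xs]] nmin.
  exists n; split; first by exists s; rewrite ?size_tuple.
  move=> s' es' xs'; apply: nmin; apply/existsP; exists (in_tuple s').
  by rewrite es' xs' /=.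
exists d; split=> [|x xc|x y exy].
- by have [_ /(_ [::] isT erefl)] := dP c; rewrite leqn0 => /eqP.
- have [[s]] := dP x; case/lastP: s => [|s z] es [xs sd] dmin.
    by rewrite xs eqxx in xc.
  rewrite last_rcons in xs; subst z.
  move: es; rewrite rcons_path => /andP[es ex].
  exists (last c s) => //; apply/eqP.
  have [[s' es' [ys' <-]] ymin] := dP (last c s).
  rewrite eqn_leq -{2}sd size_rcons ltnS (ymin s) // andbT.
  rewrite -(size_rcons s' x); apply: dmin; last by rewrite last_rcons.
  by rewrite rcons_path es' -ys'.
have [[s es [xs <-]] _] := dP x; have [_ ymin] := dP y.
rewrite -(size_rcons s y); apply: ymin; last by rewrite last_rcons.
by rewrite rcons_path es -xs.
Qed.

Section Supersolution.
Context {R : realType} {T : finType}.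
Variable e : rel T.
Hypothesis e_sym : symmetric e.
Hypothesis e_conn : forall x y, connect e x y.

(** Two distinct vertices at the same distance would share their predecessor, by induction. It would
    then have two neighbours if it is [l], and otherwise three, counting its own predecessor. *)
Lemma chain_distance (l : T) (d : T -> nat) :
  d l = 0%N -> (forall x, x != l -> exists2 y, e y x & d x = (d y).+1) ->
  (#|e l| <= 1)%N -> (forall x, #|e x| <= 2)%N ->
  [/\ injective d, forall x, (d x < #|T|)%N &
    forall x, ((d x).+1 < #|T|)%N -> exists2 y, e x y & d y = (d x).+1].
Proof.
move=> dl dS l1 l2.
have d_inj : injective d.
  suff H m : forall x y, d x = m -> d y = m -> x = y.
    by move=> x y xy; exact: H xy erefl.
  elim: m => [|m IH] x y dx dy.
    have z0 z' : d z' = 0%N -> z' = l.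
      move=> dz; apply/eqP; apply/negPn/negP => /dS[y' _].
      by rewrite dz.
    by rewrite (z0 x) // (z0 y).
  have xl : x != l by apply: contra_eq_neq dx => ->; rewrite dl.
  have yl : y != l by apply: contra_eq_neq dy => ->; rewrite dl.
  have [x' ex dx'] := dS x xl; have [y' ey dy'] := dS y yl.
  have xy' : x' = y' by apply: IH; lia.
  subst y'; apply/eqP; apply/negPn/negP => xy.
  have [x'l|x'l] := eqVneq x' l.
    have : (#|pred2 x y| <= #|e l|)%N.
      apply/subset_leq_card/fintype.subsetP => z.
      by move=> /pred2P[->|->]; rewrite -topredE /= -x'l.
    by rewrite card2 xy; lia.
  have [z ez dz] := dS x' x'l.
  have zx : z != x by apply/eqP => zx; subst z; lia.
  have zy : z != y by apply/eqP => zy; subst z; lia.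
  have : (#|pred3 x y z| <= #|e x'|)%N.
    apply/subset_leq_card/fintype.subsetP => u.
    by rewrite !inE => /or3P[] /eqP ->; rewrite -topredE /= // e_sym.
  have : uniq [:: x; y; z] by rewrite /= !inE negb_or xy eq_sym zx eq_sym zy.
  have -> : #|pred3 x y z| = #|[:: x; y; z]| by apply: eq_card => u; rewrite !inE.
  by move=> /card_uniqP ->; have := l2 x'; rewrite /=; lia.
have d_closed x j : (j <= d x)%N -> exists y, d y = j.
  have [m] := ubnP (d x); elim: m x => // m IH x; rewrite ltnS => dx.
  rewrite leq_eqVlt => /predU1P[->|jx]; first by exists x.
  have [xl|/dS[y _ dy]] := eqVneq x l; first by rewrite xl dl in jx.
  by apply: (IH y); lia.
split=> // x.
  have /choice[y yP] : forall j : 'I_(d x).+1, exists y, d y = j.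
    by move=> j; apply: (d_closed x); rewrite -ltnS.
  have y_inj : injective y.
    by move=> i j ij; apply: val_inj; rewrite /= -!yP ij.
  by rewrite -[(d x).+1]card_ord; exact: leq_card y_inj.
move=> xT; have [z dz|nz] := pickP [pred z | d x < d z]%N.
  have [y dy] := d_closed z (d x).+1 dz.
  have yl : y != l by apply: contra_eq_neq dy => ->; rewrite dl.
  have [x' ex' dx'] := dS y yl; exists y => //.
  by rewrite (_ : x = x') //; apply: d_inj; lia.
have dx z : (d z < (d x).+1)%N by rewrite ltnS leqNgt; apply/negbT/(nz z).
(* If no vertex were farther than [x], the distance would embed [T] into [d x + 1] values. *)
have : injective (fun z => Ordinal (dx z)).
  by move=> z z' [] /d_inj.
by move=> /leq_card; rewrite card_ord leqNgt xT.
Qed.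

(* If some vertex [c] has degree at least 3, [3 ^- dist(c, x)] is a
   supersolution for 4; if all degrees are at least 2, constants are; otherwise the
   graph is a path and its top eigenvector, made positive by alternating signs, works. *)
Lemma supersolution_exists : (2 <= #|T|)%N ->
  exists2 g : T -> R, (forall x, 0 < g x) &
    forall x, path_top_value #|T| * g x <= \sum_(y | e x y) (g x + g y).
Proof.
move=> T2.
have [c c3|deg2] := pickP [pred c | 2 < #|e c|]%N.
  have [d [dc dS dL]] := distance_exists (e_conn c).
  exists (fun x => 3 ^- (d x)) => [x|x]; first by rewrite invr_gt0 exprn_gt0.
  have g0 z : 0 < 3 ^- (d z) :> R by rewrite invr_gt0 exprn_gt0.
  apply: (@le_trans _ _ (4 * 3 ^- (d x))).
    by rewrite ler_wpM2r ?path_top_value_le4 // ltW.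
  have [->|/dS[y eyx dx]] := eqVneq x c.
    rewrite dc expr0 invr1 mulr1.
    (* At [c] at least three neighbours contribute [1 + 1/3] or more each. *)
    apply: (@le_trans _ _ (\sum_(y | e c y) (1 + 3^-1 : R))).
      rewrite sumr_const -mulr_natl; move: c3.
      by rewrite /= -(ler_nat R); lra.
    apply: ler_sum => y /dL; rewrite dc => dy.
    rewrite lerD2l; case: (d y) dy => [|[|//]] _; rewrite ?expr0 ?expr1 ?invr1 //; lra.
  rewrite (bigD1 y) /=; last by rewrite e_sym.
  (* Elsewhere the neighbour nearer to [c], with value three times that at [x], is enough. *)
  apply: (@le_trans _ _ (3 ^- (d x) + 3 ^- (d y))).
    rewrite dx exprS; have := g0 y; rewrite invfM; lra.
  by rewrite lerDl sumr_ge0 // => z _; rewrite addr_ge0 // ltW.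
have {}deg2 x : (#|e x| <= 2)%N by rewrite leqNgt; apply/negbT/(deg2 x).
have [l l1|deg1] := pickP [pred l | #|e l| <= 1]%N; last first.
  exists (fun=> 1) => // x; rewrite mulr1 (le_trans (path_top_value_le4 _)) //.
  rewrite sumr_const -mulr_natl; have := deg1 x; rewrite /= leqNgt => /negbFE.
  by rewrite -(ler_nat R); lra.
have [d [dl dS dL]] := distance_exists (e_conn l).
have [d_inj dT dnext] := chain_distance dl dS l1 deg2.
have g0 x : 0 < path_top_vector #|T| (d x) :> R by rewrite path_top_vector_gt0.
exists (fun x => path_top_vector #|T| (d x)) => // x.
set n := #|T|; pose S j : R := path_top_vector n j.
rewrite path_top_vectorE ?dT //.
have SS y : 0 <= S (d x) + S (d y) by rewrite addr_ge0 // ltW.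
case: ifPn => [/dnext[z exz dz]|nx].
  rewrite (bigD1 z) //= dz [leLHS]addrC lerD2l.
  case dxE : (d x) => [|j].
    by rewrite -dxE sumr_ge0 // => z' _; exact: SS.
  have [|y eyx dy] := dS x; first by apply: contra_eq_neq dxE => ->; rewrite dl.
  rewrite (bigD1 y) /=; last first.
    by rewrite e_sym eyx; apply/eqP => yz; subst z; lia.
  rewrite dxE in dy; have -> : d y = j by lia.
  rewrite -dxE lerDl sumr_ge0 // => z' _; exact: SS.
rewrite addr0; case dxE : (d x) => [|j]; first by rewrite dxE in nx; lia.
have [|y eyx dy] := dS x; first by apply: contra_eq_neq dxE => ->; rewrite dl.
rewrite (bigD1 y) /=; last by rewrite e_sym.
rewrite dxE in dy; have -> : d y = j by lia.
by rewrite -dxE lerDl sumr_ge0 // => z' _; exact: SS.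
Qed.

End Supersolution.

(** * Energy of weighted graphs *)

Lemma sum_sig {M : nmodType} {T : finType} (P : pred T) (F : T -> M) :
  \sum_(x | P x) F x = \sum_(z : {x | P x}) F (val z).
Proof.
rewrite (reindex_omap (val : {x | P x} -> T) insub) => [|x Px] /=; last first.
  by rewrite insubT.
by apply: eq_bigl => z; rewrite (valP z) valK eqxx.
Qed.

Section Laplacian.
Context {R : realType} {V : finType}.
Variables (G : sgraph V) (w : V -> V -> R).
Hypothesis w_sym : forall x y, w x y = w y x.

Notation lap := (laplacian G (@unit_measure R V) w).

Lemma laplacianE v x : lap v x = \sum_y (v x - v y) * ext_weight G w x y.
Proof. by rewrite ffunE /unit_measure invr1 mul1r. Qed.

Lemma laplacian_linear : linear lap.
Proof.
move=> a u v; apply/ffunP => x.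
rewrite [RHS]ffunE [X in _ = X + _]ffunE !laplacianE scaler_sumr -big_split.
by apply: eq_bigr => y _ /=; rewrite !ffunE /GRing.scale /=; ring.
Qed.

Lemma ext_weight_sym x y : ext_weight G w x y = ext_weight G w y x.
Proof. by rewrite /ext_weight adj_sym w_sym. Qed.

(** The sum runs over ordered pairs, so each edge is counted twice; hence the factor [2^-1] in the
    Dirichlet form. *)
Definition energy (u v : V -> R) : R :=
  \sum_x \sum_y (u x - u y) * (v x - v y) * ext_weight G w x y.

(** Green's formula, by averaging over the two orientations of each edge. *)
Lemma dot_laplacian u v : dot (lap u) v = 2^-1 * energy u v.
Proof.
have -> : energy u v = dot (lap u) v + dot (lap u) v.
  have E : dot (lap u) v =
      \sum_x \sum_y (u x - u y) * v x * ext_weight G w x y.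
    apply: eq_bigr => x _; rewrite laplacianE mulr_suml.
    by apply: eq_bigr => y _; ring.
  rewrite {1}E E [X in _ + X]exchange_big -big_split /=.
  apply: eq_bigr => x _; rewrite -big_split; apply: eq_bigr => y _ /=.
  by rewrite (ext_weight_sym y x); ring.
by field.
Qed.

Lemma laplacian_sym u v : dot (lap u) v = dot u (lap v).
Proof.
rewrite [RHS]dotC !dot_laplacian; congr (_ * _).
by apply: eq_bigr => x _; apply: eq_bigr => y _; congr (_ * _); rewrite mulrC.
Qed.

Lemma energy_ge0 u : (forall x y, 0 <= w x y) -> 0 <= energy u u.
Proof.
move=> w0; apply: sumr_ge0 => x _; apply: sumr_ge0 => y _.
rewrite mulr_ge0 -?expr2 ?sqr_ge0 // /ext_weight; case: ifP => // _.
Qed.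

Lemma energy_eq0_edge u x y : (forall x y, 0 < w x y) -> energy u u = 0 ->
  adj G x y -> u x = u y.
Proof.
move=> w0 /eqP; have w0' z t : 0 <= ext_weight G w z t.
  by rewrite /ext_weight; case: ifP => // _; exact: ltW.
have F0 z t : 0 <= (u z - u t) * (u z - u t) * ext_weight G w z t.
  by rewrite mulr_ge0 // -expr2 sqr_ge0.
rewrite psumr_eq0 => [/allP/(_ x (mem_index_enum _))/= /eqP/eqP|z _]; last first.
  exact: sumr_ge0.
rewrite psumr_eq0 => [/allP/(_ y (mem_index_enum _))/=|z _]; last exact: F0.
move=> + xy; rewrite /ext_weight xy mulf_eq0 (gt_eqF (w0 x y)) orbF -expr2.
by rewrite sqrf_eq0 subr_eq0 => /eqP.
Qed.

Lemma laplacian_eigval_ge0 i : (forall x y, 0 <= w x y) ->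
  0 <= laplacian_eigval G (@unit_measure R V) w i.
Proof.
move=> w0; have E := linfun_linearE laplacian_linear.
apply: eigval_ge0 => [u v|u]; first by rewrite !E laplacian_sym.
by rewrite E dot_laplacian mulr_ge0 ?energy_ge0.
Qed.

Section Inner.
Variable B : {set V}.
Notation T := (inner B).

Lemma sum_inner (F : V -> R) : (forall x, x \in B -> F x = 0) ->
  \sum_x F x = \sum_(z : T) F (val z).
Proof.
move=> F0; rewrite -sum_sig [LHS](bigID (fun x => x \notin B)) /=.
by rewrite [X in _ + X]big1 ?addr0 // => x /negPn /F0.
Qed.

Lemma extend0_val (u : {ffun T -> R^o}) z : extend0 u (val z) = u z.
Proof. by rewrite ffunE valK. Qed.

Lemma extend0_boundary (u : {ffun T -> R^o}) x : x \in B -> extend0 u x = 0.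
Proof. by move=> xB; rewrite ffunE insubF ?xB. Qed.

Lemma extend0_linear : linear (@extend0 R V B).
Proof.
move=> a u v; apply/ffunP => x; rewrite !ffunE.
by case: insubP => [z _ _|_]; rewrite ?ffunE // scaler0 addr0.
Qed.

Lemma restrict_linear : linear (@Defs.restrict R V B).
Proof. by move=> a u v; apply/ffunP => x; rewrite !ffunE. Qed.

Notation dir := (dirichlet_laplacian G (@unit_measure R V) w (B := B)).

Lemma dirichlet_linear : linear dir.
Proof.
by move=> a u v; rewrite /dir extend0_linear laplacian_linear restrict_linear.
Qed.

Lemma dot_dirichlet u v : dot (dir u) v = 2^-1 * energy (extend0 u) (extend0 v).
Proof.
rewrite -dot_laplacian /dot [RHS]sum_inner => [|x xB]; last first.
  by rewrite extend0_boundary ?mulr0.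
by apply: eq_bigr => z _; rewrite [dir u z]ffunE extend0_val.
Qed.

Lemma dirichlet_sym u v : dot (dir u) v = dot u (dir v).
Proof.
rewrite [RHS]dotC !dot_dirichlet; congr (_ * _).
by apply: eq_bigr => x _; apply: eq_bigr => y _; congr (_ * _); rewrite mulrC.
Qed.

Lemma dirichlet_eigval1_min u :
  dirichlet_eigval G B (@unit_measure R V) w 1 * dot u u <= dot (dir u) u.
Proof.
have E := linfun_linearE dirichlet_linear.
rewrite -[in leRHS]E; apply: eigval1_min => u' v'.
by rewrite !E dirichlet_sym.
Qed.

Lemma dirichlet_eigval_ge0 i : (forall x y, 0 <= w x y) ->
  0 <= dirichlet_eigval G B (@unit_measure R V) w i.
Proof.
move=> w0; have E := linfun_linearE dirichlet_linear.
apply: eigval_ge0 => [u v|u]; first by rewrite !E dirichlet_sym.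
by rewrite E dot_dirichlet mulr_ge0 ?energy_ge0.
Qed.

End Inner.
End Laplacian.

(** * Harmonic extension and Neumann eigenvalues *)

Section Neumann.
Context {R : realType} {V : finType}.
Variables (G : sgraph V) (w : V -> V -> R) (B : {set V}).
Hypothesis w_sym : forall x y, w x y = w y x.
Hypothesis w_gt0 : forall x y, 0 < w x y.
Hypothesis G_conn : graph_connected G.
Hypothesis inner_gt0 : (0 < #|~: B|)%N.

Notation lap := (laplacian G (@unit_measure R V) w).
Notation T := (inner B).
Notation neu := (neumann_laplacian G (@unit_measure R V) w (B := B)).
Notation ext := (neumann_ext G (@unit_measure R V) w (B := B)).

(** At every vertex either [v] or its Laplacian vanishes, so the energy is zero; by connectedness
    [v] is constant, and it vanishes at an interior vertex. *)
Lemma harmonic_zero (v : {ffun V -> R^o}) : (forall x, x \notin B -> v x = 0) ->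
  (forall x, x \in B -> lap v x = 0) -> v = 0.
Proof.
move=> v0 lv0; have /card_gt0P[z zB] := inner_gt0.
have E0 : energy G w v v = 0.
  have : dot (lap v) v = 0.
    apply: big1 => x _; have [/lv0 ->|/v0 ->] := boolP (x \in B).
      by rewrite mul0r.
    by rewrite mulr0.
  rewrite (dot_laplacian G w_sym) => /eqP.
  by rewrite mulf_eq0 invr_eq0 pnatr_eq0 /= => /eqP.
have vE x y : connect (adj G) x y -> v x = v y.
  move=> /connectP[s xs ->]; elim: s x xs => //= x' s IH x /andP[xx' /IH <-].
  exact: energy_eq0_edge w_gt0 E0 xx'.
apply/ffunP => x; rewrite ffunE (vE x z) ?v0 //.
by rewrite inE in zB.
Qed.

(* Its bijectivity is the existence and uniqueness of harmonic extensions. *)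
Definition boundary_map (v : {ffun V -> R^o}) : {ffun V -> R^o} :=
  [ffun x => if x \in B then lap v x else v x].

Lemma boundary_map_linear : linear boundary_map.
Proof.
move=> a u v; apply/ffunP => x; rewrite !ffunE.
have /ffunP/(_ x) := laplacian_linear G w a u v; rewrite !ffunE => ->.
by case: ifP.
Qed.

Lemma harmonic_ext_exists (u : {ffun T -> R^o}) :
  exists v, is_harmonic_ext G (@unit_measure R V) w u v.
Proof.
have E := linfun_linearE boundary_map_linear.
(* Uniqueness gives existence: an injective endomorphism in finite dimension is onto. *)
have ker0 : lker (linfun boundary_map) == 0%VS.
  apply/lker0P => v v' /eqP; rewrite -subr_eq0 -linearB /= E => /eqP/ffunP bv.
  apply/eqP; rewrite -subr_eq0; apply/eqP/harmonic_zero => x xB.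
    by have := bv x; rewrite [in LHS]ffunE (negbTE xB) [RHS]ffunE.
  by have := bv x; rewrite [in LHS]ffunE xB [RHS]ffunE.
have imf : limg (linfun boundary_map) = fullv.
  by apply/eqP; rewrite eqEdim subvf limg_dim_eq ?(eqP ker0) ?capv0 ?leqnn.
have : extend0 u \in limg (linfun boundary_map) by rewrite imf memvf.
case/memv_imgP => v _; rewrite E => /ffunP uv; exists v; split.
  apply/ffunP => z; have := uv (val z); rewrite extend0_val ffunE.
  by rewrite (negbTE (valP z)) => ->; rewrite ffunE.
by move=> x xB; have := uv x; rewrite extend0_boundary // ffunE xB.
Qed.

Lemma neumann_extP u : is_harmonic_ext G (@unit_measure R V) w u (ext u).
Proof. exact: xgetPex (harmonic_ext_exists u). Qed.

Lemma neumann_ext_val u z : ext u (val z) = u z.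
Proof. by have [/ffunP/(_ z) <- _] := neumann_extP u; rewrite ffunE. Qed.

Lemma neumann_ext_boundary u x : x \in B -> lap (ext u) x = 0.
Proof. by have [_] := neumann_extP u; apply. Qed.

Lemma neumann_ext_linear : linear ext.
Proof.
move=> a u v; apply/eqP; rewrite -subr_eq0; apply/eqP/harmonic_zero => x xB.
  pose z : T := Sub x xB; rewrite -[x]/(val z).
  by rewrite !ffunE !neumann_ext_val !ffunE subrr.
have -> : ext (a *: u + v) - (a *: ext u + ext v) =
    (- 1) *: (a *: ext u + ext v) + ext (a *: u + v) by rewrite scaleN1r addrC.
rewrite !(laplacian_linear G w) [LHS]ffunE [X in X + _]ffunE [X in _ *: X + _]ffunE.
rewrite [X in _ *: (X + _) + _]ffunE !neumann_ext_boundary //.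
by rewrite !(scaler0, addr0).
Qed.

Lemma neumann_linear : linear neu.
Proof.
move=> a u v.
by rewrite /neumann_laplacian neumann_ext_linear (laplacian_linear G w) restrict_linear.
Qed.

(** In Green's formula for the extensions the boundary terms vanish, as [ext u] is harmonic
    there. *)
Lemma dot_neumann u v : dot (neu u) v = 2^-1 * energy G w (ext u) (ext v).
Proof.
rewrite -(dot_laplacian G w_sym) /dot [RHS](sum_inner (B := B)) => [|x xB]; last first.
  by rewrite neumann_ext_boundary ?mul0r.
by apply: eq_bigr => z _; rewrite [neu u z]ffunE neumann_ext_val.
Qed.

Lemma neumann_sym u v : dot (neu u) v = dot u (neu v).
Proof.
rewrite [RHS]dotC !dot_neumann; congr (_ * _).
by apply: eq_bigr => x _; apply: eq_bigr => y _; congr (_ * _); rewrite mulrC.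
Qed.

Lemma dot_neumann_ext_le u : dot u u <= dot (ext u) (ext u).
Proof.
rewrite /dot [leRHS](bigID (fun x => x \notin B)) /=.
rewrite [X in _ <= X + _]sum_sig.
rewrite [X in _ <= X + _](eq_bigr (fun z => u z * u z)) => [|z _]; last first.
  by rewrite neumann_ext_val.
by rewrite lerDl sumr_ge0 // => x _; rewrite -expr2 sqr_ge0.
Qed.

(** The conditions are pulled back along the linear map [ext], which does not decrease the norm;
    this preserves the bound because [a] is nonnegative. *)
Lemma neumann_eigval_ge (a : R) (L : seq 'Hom({ffun V -> R^o}, R^o)) i :
  0 <= a -> (size L < i <= #|~: B|)%N ->
  (forall f : {ffun V -> R^o}, (forall l, l \in L -> l f = 0) ->
    a * \sum_x f x ^+ 2 <= 2^-1 * energy G w f f) ->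
  a <= neumann_eigval G B (@unit_measure R V) w i.
Proof.
move=> a0 Li aL; have E := linfun_linearE neumann_linear.
have Ee := linfun_linearE neumann_ext_linear.
have cT : #|{: T}| = #|~: B|.
  by rewrite card_sig; apply: eq_card => x; rewrite !inE.
apply: (@eigval_ge R T (linfun neu) _ a [seq (l \o linfun ext)%VF | l <- L]).
- by move=> u v; rewrite !E neumann_sym.
- by rewrite size_map cT.
move=> u uL; rewrite E dot_neumann.
apply: le_trans (aL (ext u) _).
  apply: ler_wpM2l => //; apply: le_trans (dot_neumann_ext_le u) _.
  by apply: ler_sum => x _; rewrite expr2.
move=> l lL; rewrite -Ee -comp_lfunE; apply: uL.
by apply/mapP; exists l.
Qed.

End Neumann.

Section PathOperators.
Context {R : realType}.

Lemma path_energy n (w : 'I_n.+1 -> 'I_n.+1 -> R) (v : nat -> R) :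
  (forall x y, w x y = w y x) ->
  2^-1 * energy (path_graph n.+1) w (fun x => v x) (fun x => v x) =
  \sum_(j < n) (v j.+1 - v j) ^+ 2 * w (inord j.+1) (inord j).
Proof.
move=> w_sym; pose F (x y : 'I_n.+1) : R := (v x - v y) ^+ 2 * w x y.
(* Each edge is counted once, from its larger end. *)
pose up : R := \sum_(x < n.+1) \sum_(y < n.+1 | y.+1 == x) F x y.
have upE : up = \sum_(j < n) (v j.+1 - v j) ^+ 2 * w (inord j.+1) (inord j).
  rewrite /up big_ord_recl big1 ?add0r; last by move=> y; rewrite //.
  apply: eq_bigr => j _; rewrite (big_pred1 (inord j)) => [|y /=].
    rewrite /F /= inordK; last by rewrite ltnS ltnW.
    by congr (_ * w _ _); apply: val_inj; rewrite /= inordK ?ltnS.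
  rewrite /bump leq0n add1n eqSS; apply/eqP/eqP => [<-|->].
    by rewrite inord_val.
  by rewrite inordK // ltnS ltnW.
rewrite -upE.
suff -> : energy (path_graph n.+1) w (fun x => v x) (fun x => v x) = up + up by field.
rewrite {2}/up (exchange_big_dep xpredT) //= -big_split; apply: eq_bigr => x _ /=.
rewrite [X in X + _]big_mkcond [X in _ + X]big_mkcond -big_split.
apply: eq_bigr => y _; rewrite /ext_weight /= /path_adj /F.
have [yx|yx] := eqVneq y.+1 x; have [xy|xy] := eqVneq x.+1 y => /=.
- lia.
- by ring.
- by rewrite w_sym; ring.
by rewrite mulr0 addr0.
Qed.

Lemma path_weight_sym k (c : R) x y : @path_weight R k c x y = path_weight c y x.
Proof. by rewrite /path_weight orbC. Qed.

Lemma dirichlet_path_bound k (c : R) : (0 < k)%N ->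
  path_bound k c (dirichlet_eigval (path_graph k.+1) [set ord0]
    (@unit_measure R _) (path_weight c) 1).
Proof.
case: k => // k _ x.
pose B : {set 'I_k.+2} := [set ord0].
(* Vertex [j + 1] of the path carries [x j], and the boundary vertex [0] carries [0]. *)
pose vv n : R := if n is m.+1 then x m else 0.
pose u : {ffun inner B -> R^o} := [ffun z => vv (val (val z))].
have uE (y : 'I_k.+2) : extend0 u y = vv y.
  rewrite ffunE; case: insubP => [z _ <-|]; first by rewrite ffunE.
  by rewrite !inE negbK => /eqP ->.
have := dirichlet_eigval1_min (path_graph k.+2) (@path_weight_sym k.+1 c) u.
rewrite (dot_dirichlet _ (@path_weight_sym k.+1 c)).
have -> : energy (path_graph k.+2) (path_weight c) (extend0 u) (extend0 u) =
    energy (path_graph k.+2) (path_weight c) (fun y => vv y) (fun y => vv y).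
  by apply: eq_bigr => y _; apply: eq_bigr => z _; rewrite !uE.
rewrite (path_energy vv (@path_weight_sym k.+1 c)) big_ord_recl /=.
have -> : dot u u = \sum_(j < k.+1) x j ^+ 2.
  rewrite /dot (eq_bigr (fun z : inner B => vv (val z) * vv (val z))); last first.
    by move=> z _; rewrite ffunE.
  rewrite -(sum_inner (B := B) (F := fun y : 'I_k.+2 => vv y * vv y)).
    by rewrite big_ord_recl /= mul0r add0r; apply: eq_bigr => j _; rewrite expr2.
  by move=> y; rewrite inE => /eqP ->; rewrite mul0r.
move=> /le_trans; apply; apply: lerD.
  rewrite subr0 mulrC ler_wpM2r ?sqr_ge0 // /path_weight.
  have -> : inord 0 = ord0 :> 'I_k.+2 by apply: val_inj; rewrite /= inordK.
  by rewrite eqxx orbT.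
apply: ler_sum => j _; have jk := ltn_ord j.
rewrite /path_weight ifF ?mulr1 //.
apply/negbTE; rewrite negb_or -!(inj_eq val_inj) /= !inordK //.
by rewrite /bump; lia.
Qed.

End PathOperators.

(** * Assembling the bounds *)

Section LaplacianUpperBound.
Context {R : realType}.

(* Evaluate the eigenvalue equation where [`|u| / g] is maximal. *)
Lemma laplacian_eigenvalue_le (V : finType) (G : sgraph V) (g : V -> R)
    (c mu : R) (u : {ffun V -> R^o}) :
  (forall x, 0 < g x) ->
  (forall x, \sum_(y | adj G x y) (g x + g y) <= c * g x) ->
  u != 0 -> laplacian G unit_measure unit_weight u = mu *: u -> mu <= c.
Proof.
move=> g0 gc u0 lu.
have [x1 ux1] : exists x, u x != 0.
  apply/existsP; apply: contraNT u0; rewrite negb_exists => /forallP u0.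
  by apply/eqP/ffunP => x; rewrite ffunE; apply/eqP; have := u0 x; rewrite negbK.
have [x _ xmax] := @arg_maxP _ R V x1 xpredT (fun x => `|u x| / g x) isT.
have uM y : `|u y| <= `|u x| / g x * g y.
  by rewrite -ler_pdivrMr //; exact: xmax.
have ux : 0 < `|u x|.
  have := xmax x1 isT; have : 0 < `|u x1| / g x1 by rewrite divr_gt0 ?normr_gt0.
  by move=> /lt_le_trans H /H; rewrite pmulr_lgt0 // invr_gt0.
rewrite -(ler_pM2r ux); apply: (@le_trans _ _ `|mu * u x|).
  by rewrite normrM ler_wpM2r // ler_norm.
have -> : mu * u x = \sum_(y | adj G x y) (u x - u y).
  transitivity (laplacian G unit_measure unit_weight u x); first by rewrite lu ffunE.
  rewrite laplacianE [RHS]big_mkcond; apply: eq_bigr => y _.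
  by rewrite /ext_weight /unit_weight; case: ifP; rewrite ?mulr1 ?mulr0.
apply: le_trans (ler_norm_sum _ _ _) _.
apply: (@le_trans _ _ (\sum_(y | adj G x y) `|u x| / g x * (g x + g y))).
  apply: ler_sum => y _; rewrite mulrDr divfK ?gt_eqF //.
  by rewrite (le_trans (ler_normB _ _)) // lerD2l.
rewrite -mulr_sumr; apply: (@le_trans _ _ (`|u x| / g x * (c * g x))).
  by rewrite ler_wpM2l // ltW // divr_gt0.
by rewrite le_eqVlt; apply/orP; left; apply/eqP; field; rewrite gt_eqF.
Qed.

(** An upper bound is all that is wanted, since [path_bound_le] allows the potential to be raised.
    The test function is the positive eigenvector of the signless Laplacian. *)
Lemma path_laplacian_eigval_le n i : (0 < n)%N ->
  laplacian_eigval (path_graph n) unit_measure unit_weight i <= path_top_value n :> R.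
Proof.
move=> n0; have ws (x y : 'I_n) : unit_weight x y = unit_weight y x :> R by [].
have E := linfun_linearE (laplacian_linear (path_graph n) (@unit_weight R _)).
rewrite /laplacian_eigval.
pose f := linfun (laplacian (path_graph n) (@unit_measure R _) unit_weight).
have [|->|[u u0]] := @eigval_eigenvector R _ f _ i.
- by move=> u v; rewrite !E (laplacian_sym _ ws).
(* The value [0] is also below [2 + 2 cos (pi / n)]. *)
- by rewrite /path_top_value; have := @cos_geN1 R (pi / n%:R); lra.
rewrite E.
apply: (laplacian_eigenvalue_le (g := fun x : 'I_n => path_top_vector n x)) => //.
  by move=> x; exact: path_top_vector_gt0.
move=> x; rewrite path_top_vectorE //.
pose F y : R := path_top_vector n x + path_top_vector n y.
rewrite big_mkcond /=.
have -> : \sum_(y < n) (if path_adj x y then F y else 0) =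
    \sum_(y < n | y.+1 == x) F y + \sum_(y < n | x.+1 == y) F y.
  rewrite [X in X + _]big_mkcond [X in _ + X]big_mkcond -big_split.
  apply: eq_bigr => y _; rewrite /path_adj.
  have [yx|yx] := eqVneq y.+1 x; have [xy|xy] := eqVneq x.+1 y => /=; last first.
  - by rewrite addr0.
  - by rewrite add0r.
  - by rewrite addr0.
  lia.
apply: lerD.
  case: x @F => -[|m] mn F /=.
    by rewrite big_pred0.
  by rewrite (big_pred1 (Ordinal (ltnW mn))).
case: ifPn => [xn|xn].
  by rewrite (big_pred1 (Ordinal xn)) // => y; rewrite /= eq_sym.
by rewrite big_pred0 // => y; apply/negbTE; have := ltn_ord y; lia.
Qed.

End LaplacianUpperBound.

Section SpanningTree.
Context {R : realType} {V : finType}.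
Variable G : sgraph V.
Hypothesis G_conn : graph_connected G.

Lemma spanning_tree_exists (r : V) : exists (p : V -> V) (d : V -> nat),
  [/\ p r = r, forall x, x != r -> (d (p x) < d x)%N &
      forall x, x != r -> adj G x (p x)].
Proof.
have [d [dr dS _]] := distance_exists (G_conn r).
have /choice[p pP] : forall x, exists y, if x == r then y = r else
    adj G x y /\ (d y < d x)%N.
  move=> x; have [_|/dS[y yx ->]] := eqVneq x r; first by exists r.
  by exists y; rewrite adj_sym.
exists p, d; split=> [|x xr|x xr]; first by have := pP r; rewrite eqxx.
  by have := pP x; rewrite (negbTE xr) => -[].
by have := pP x; rewrite (negbTE xr) => -[].
Qed.

(** The depth prevents an edge from going upward in both directions, so each tree edge is met
    exactly once in each of the two sums. *)
Lemma energy_in_le_energy (p : V -> V) (d : V -> nat) (r : V)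
    (f : V -> R) :
  (forall x, x != r -> (d (p x) < d x)%N) ->
  (forall x, x != r -> adj G x (p x)) ->
  energy_in p [set: V] r f <= 2^-1 * energy G unit_weight f f.
Proof.
move=> dp pG; set e := energy_in _ _ _ _.
suff : e + e <= energy G unit_weight f f by lra.
pose up (x y : V) := (x != r) && (y == p x).
have eE : e = \sum_x \sum_(y | up x y) (f x - f y) ^+ 2.
  rewrite /e /energy_in big_mkcond; apply: eq_bigr => x _; rewrite in_setT /=.
  rewrite /up; case: (x != r) => /=; last by rewrite big_pred0.
  by rewrite (big_pred1 (p x)).
rewrite {1}eE eE [X in _ + X](exchange_big_dep xpredT) //= -big_split.
apply: ler_sum => x _ /=.
rewrite [X in X + _]big_mkcond [X in _ + X]big_mkcond -big_split.
apply: ler_sum => y _ /=; rewrite /ext_weight /unit_weight.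
have : ~~ (up x y && up y x).
  apply/negP => /andP[/andP[xr /eqP yx] /andP[yr /eqP xy]].
  by have := dp x xr; have := dp y yr; rewrite -yx -xy; lia.
have upG a b : up a b -> adj G a b by move=> /andP[ar /eqP ->]; exact: pG.
have [xy|xy] := boolP (up x y); have [yx|yx] := boolP (up y x) => // _.
- by rewrite upG // mulr1 expr2 addr0.
- by rewrite adj_sym upG // mulr1 expr2 add0r; lra.
- by rewrite addr0 mulr_ge0 // -?expr2 ?sqr_ge0 //; case: ifP.
Qed.

End SpanningTree.

Section QuotientTree.
Context {R : realType} {V : finType}.
Variables (p : V -> V) (d : V -> nat) (r : V).
Hypothesis dp : forall x, x != r -> (d (p x) < d x)%N.
Variables (k : nat) (tau : V -> V).
Hypothesis tauT : tiling p r [set: V] k tau.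

(** Apply [supersolution_exists] to the quotient tree, whose vertices are the tops, and extend the
    result constantly over each tile. *)
Lemma tiling_supersolution : (2 <= #|[pred t | tau t == t]|)%N ->
  exists2 g : V -> R, (forall x, 0 < g x) &
  forall t, tau t = t ->
    path_top_value #|[pred t | tau t == t]| * g t <=
    (if t != r then g t + g (tau (p t)) else 0) +
    \sum_(c | [&& tau c == c, c != r & tau (p c) == t]) (g t + g c).
Proof.
move=> n2; pose T : finType := {t : V | tau t == t}.
have tauK' x : tau (tau x) == tau x by rewrite (tauK tauT).
pose top (x : V) : T := exist _ (tau x) (tauK' x).
have top_val (t : T) : top (val t) = t.
  by apply: val_inj; rewrite /=; apply/eqP/(valP t).
pose up (s t : T) := (val s != r) && (t == top (p (val s))).
pose e : rel T := fun s t => up s t || up t s.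
have e_sym : symmetric e by move=> s t; rewrite /e orbC.
have d_tau x : (d (tau x) <= d x)%N.
  have [m] := ubnP (d x); elim: m x => // m IH x; rewrite ltnS => dx.
  have [->//|/(tau_parent tauT)[xr <-]] := eqVneq (tau x) x.
  by have := dp xr => dpx; rewrite (leq_trans (IH _ _)) ?(ltnW dpx) // (leq_trans dpx).
have tr : tau r == r.
  by apply/negPn/negP => /(tau_parent tauT)[]; rewrite eqxx.
(* Passing to the parent tile lowers the depth of the top, which leads to the tile of the root. *)
have conn_r (s : T) : connect e s (top r).
  have [m] := ubnP (d (val s)); elim: m s => // m IH s; rewrite ltnS => ds.
  have [sr|sr] := eqVneq (val s) r; first by rewrite -sr top_val connect0.
  apply: connect_trans (IH (top (p (val s))) _).
    by apply: connect1; rewrite /e /up sr eqxx.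
  rewrite /= (leq_ltn_trans (d_tau _)) // (leq_trans (dp sr)) //.
have e_conn s t : connect e s t.
  apply: connect_trans (conn_r s) _.
  by rewrite (sym_connect_sym e_sym).
have cT : #|T| = #|[pred t | tau t == t]| by rewrite card_sig.
have [|g g0 gT] := @supersolution_exists R T e e_sym e_conn; first by rewrite cT.
exists (fun x => g (top x)) => // t tt; rewrite -cT (le_trans (gT _)) //.
have F0 s : 0 <= g (top t) + g s by rewrite addr_ge0 // ltW.
have ttop : val (top t) = t by [].
apply: (@le_trans _ _ (\sum_(s | up (top t) s) (g (top t) + g s) +
    \sum_(s | up s (top t)) (g (top t) + g s))).
  rewrite big_mkcond [X in _ <= X + _]big_mkcond [X in _ <= _ + X]big_mkcond.
  rewrite -big_split; apply: ler_sum => s _ /=; rewrite /e.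
  by case: (up (top t) s); case: (up s (top t)) => //=; rewrite ?addr0 ?add0r // lerDl.
apply: lerD.
  rewrite /up /= tt; case: ifP => tr' /=; last by rewrite big_pred0.
  rewrite (big_pred1 (top (p t))) //.
  have -> // : top (tau (p t)) = top (p t).
  by apply: val_inj; rewrite /= (tauK tauT).
rewrite [leRHS]big_mkcondr /= [leRHS]sum_sig -[leRHS]big_mkcond /=.
rewrite le_eqVlt; apply/orP; left; apply/eqP.
apply: eq_big => [s|s _]; last by rewrite top_val.
by rewrite /up -val_eqE /= tt [t == _]eq_sym.
Qed.

End QuotientTree.

Lemma divisible_energy_bound (R : realType) (V : finType) (G : sgraph V) (i k : nat)
    (w a : R) :
  graph_connected G -> (2 <= i)%N -> (0 < k)%N -> #|V| = (i * k)%N ->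
  w <= path_top_value i -> 0 <= a -> path_bound k w a ->
  exists2 L : seq 'Hom({ffun V -> R^o}, R^o), (size L < i)%N &
    forall f : {ffun V -> R^o}, (forall l, l \in L -> l f = 0) ->
    a * \sum_x f x ^+ 2 <= 2^-1 * energy G unit_weight f f.
Proof.
case: k => // q G_conn i2 _ cV wi a0 ka.
have /card_gt0P[r _] : (0 < #|V|)%N by rewrite cV; nia.
have [p [d [pr dp pG]]] := spanning_tree_exists G_conn r.
suff [L sL HL] : exists2 L : seq 'Hom({ffun V -> R^o}, R^o), (size L < i)%N &
    forall f : {ffun V -> R^o}, (forall l, l \in L -> l f = 0) ->
    a * \sum_x f x ^+ 2 <= energy_in p [set: V] r f.
  exists L => // f /HL /le_trans; apply.
  exact: (energy_in_le_energy f dp pG).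
have Vp : p_closed p [set: V] by move=> x _; rewrite in_setT.
(* Cut pieces have at most [q = k - 1] vertices and unit potential, whatever [w] is; only the tiles
   use the bound with [w]. *)
have qa := path_bound_pred ka.
have := cut_or_tile pr dp a0 qa Vp; rewrite cardsT cV => /(_ i erefl)[|[tau tauT]].
  move=> [L sL HL]; exists L => // f /HL.
  by rewrite (eq_bigl predT) // => x; exact: in_setT.
have ci : #|[pred t | tau t == t]| = i.
  by apply/eqP; rewrite -(eqn_pmul2r (ltn0Sn q)) (card_tops tauT) cV.
have [|g g0 gT] := @tiling_supersolution R _ _ _ _ dp _ _ tauT; first by rewrite ci.
rewrite -ci; apply: (tiled_bound dp tauT g0 (w := path_top_value i)) => //.
  by move=> t /gT; rewrite ci.
exact: path_bound_le wi ka.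
Qed.

Theorem theorem6p6 (R : realType) (V : finType) (G : sgraph V) (B : {set V})
    (i k : nat) :
  graph_connected G -> B != finset.set0 -> (2 <= i <= #|~: B|)%N ->
  k = (#|V| %/ i)%N ->
  (~~ (i %| #|V|)%N ->
     2 * (1 - cos (pi / (2 * k + 1)%:R))
       <= neumann_eigval G B (@unit_measure R V) unit_weight i)
  /\
  ((i %| #|V|)%N ->
     dirichlet_eigval (path_graph k.+1) [set ord0] (@unit_measure R _)
         (path_weight (laplacian_eigval (path_graph i) unit_measure unit_weight i))
         1
       <= neumann_eigval G B (@unit_measure R V) unit_weight i).
Proof.
move=> G_conn _ /andP[i2 iB] kE.
have iV : (i <= #|V|)%N by rewrite (leq_trans iB) // max_card.
have k0 : (0 < k)%N by rewrite kE divn_gt0 //; lia.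
have /card_gt0P[r _] : (0 < #|V|)%N by lia.
have ws (x y : V) : unit_weight x y = unit_weight y x :> R by [].
have w0 (x y : V) : 0 < unit_weight x y :> R by rewrite /unit_weight.
have B0 : (0 < #|~: B|)%N by lia.
split=> iVdvd.
  have a0 : 0 <= 2 * (1 - cos (pi / (2 * k + 1)%:R)) :> R.
    by rewrite mulr_ge0 // subr_ge0 cos_le1.
  have [p [d [pr dp pG]]] := spanning_tree_exists G_conn r.
  (* With [j = i - 2] the size condition reads [#|V| <= i * k + (i - 1)], true as the remainder is
     less than [i]; and [k < #|V|] since [i] is at least 2. *)
  have [|L sL HL] := tree_bound pr dp a0 (path_bound_cos k) (j := i.-2).
    have := divn_eq #|V| i; have := @ltn_pmod #|V| i.
    by rewrite -kE => mi Vi; nia.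
  apply: (neumann_eigval_ge ws w0 G_conn B0 (L := L)) => //.
    by rewrite iB andbT; lia.
  move=> f /HL /le_trans; apply.
  exact: (energy_in_le_energy f dp pG).
set c : R := laplacian_eigval _ _ _ _.
have ci : c <= path_top_value i by apply: path_laplacian_eigval_le; lia.
have VE : #|V| = (i * k)%N by rewrite kE mulnC divnK.
have c0 : 0 <= c by apply: laplacian_eigval_ge0 => // x y; rewrite /unit_weight.
have a0 : 0 <= dirichlet_eigval (path_graph k.+1) [set ord0] (@unit_measure R _)
    (path_weight c) 1.
  apply: dirichlet_eigval_ge0 => [x y|x y]; first exact: path_weight_sym.
  by rewrite /path_weight; case: ifP.
have [L sL HL] := divisible_energy_bound G_conn i2 k0 VE ci a0 (dirichlet_path_bound c k0).
by apply: (neumann_eigval_ge ws w0 G_conn B0 (L := L)); rewrite ?sL.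
Qed.
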